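(* Let $G=\{G_n\}_{n\in\mathbb{N}}$ be an ordered mean. Let $\mathbf{A}\in\mathbb{P}^n$, $\omega\in\Delta_n$ and $\mu,\nu>0$. Then for all $t\in[0,1]$ and $p\in[-1,1)$, $$G^{P_p(1-t,t;\mu,\nu)}(\omega;\mathbf{A})\ge P_p\left(1-t,t;G^{\frac{\mu}{K}}(\omega;\mathbf{A}),G^{\frac{\nu}{K}}(\omega;\mathbf{A})\right),\qquad K=\frac{(\mu+\nu)^2}{4\mu\nu}.$$
   Context: Let $\mathcal{H}$ be a Hilbert space and $\mathbb{P}$ the open convex cone of positive invertible bounded linear operators on $\mathcal{H}$; $I$ is the identity. For self-adjoint $A,B$, $A\le B$ means $B-A$ is positive semi-definite (Loewner order). $\Delta_n$ is the set of probability vectors $\omega=(w_1,\dots,w_n)\in\mathbb{R}^n$ with all $w_i>0$ and $\sum_i w_i=1$. An ordered mean is a family $G=\{G_n\}_{n\in\mathbb{N}}$ of maps $G_n:\Delta_n\times\mathbb{P}^n\to\mathbb{P}$ such that for every $n$, all $\mathbf{A},\mathbf{B}\in\mathbb{P}^n$, $\omega\in\Delta_n$ and real $a>0$: (P1) $G_n(\omega;a\mathbf{A})=aG_n(\omega;\mathbf{A})$; (P2) $G_n(\omega;\mathbf{B})\le G_n(\omega;\mathbf{A})$ whenever $B_i\le A_i$ for all $i$; (P3) $G_n(\omega;(1-s)\mathbf{A}+s\mathbf{B})\ge(1-s)G_n(\omega;\mathbf{A})+sG_n(\omega;\mathbf{B})$ for $0\le s\le1$; (P4) $\left[\sum_{i=1}^n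 w_iA_i^{-1}\right]^{-1}\le G_n(\omega;\mathbf{A})\le\sum_{i=1}^n w_iA_i$. Parameterized ordered mean: for real $\mu\ge0$ and $\mathbf{A}\in\mathbb{P}^n$, $G^\mu(\omega;\mathbf{A})=G_n^\mu(\omega;\mathbf{A}):=G_n(\omega;A_1+\mu I,\dots,A_n+\mu I)-\mu I$ (an element of $\mathbb{P}$). Power means: $A\#_pB=A^{1/2}(A^{-1/2}BA^{-1/2})^pA^{1/2}$. For $\lambda\in\Delta_k$ and $X_1,\dots,X_k\in\mathbb{P}$: for $p\in(0,1]$, $P_p(\lambda;X_1,\dots,X_k)$ is the unique solution $X\in\mathbb{P}$ of $X=\sum_{i=1}^k\lambda_i\,X\#_pX_i$; for $p\in[-1,0)$, $P_p(\lambda;X_1,\dots,X_k)=P_{-p}(\lambda;X_1^{-1},\dots,X_k^{-1})^{-1}$; and $P_0(\lambda;X_1,\dots,X_k)=\Lambda(\lambda;X_1,\dots,X_k)$ is the Karcher mean, the unique solution $X\in\mathbb{P}$ of $\sum_{i=1}^k\lambda_i\log(X^{1/2}X_i^{-1}X^{1/2})=0$. For positive scalars $P_p(\lambda;a_1,\dots,a_k)=(\sum_i\lambda_ia_i^p)^{1/p}$ if $p\ne0$ and $\prod_ia_i^{\lambda_i}$ if $p=0$. Convention at the endpoints: $P_p(1,0;X,Y)=X$ and $P_p(0,1;X,Y)=Y$. *)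

(* Defs.v *)
From HB Require Import structures.
From mathcomp Require Import all_boot all_order all_algebra.
From mathcomp Require Import all_classical all_reals all_analysis.
From mathcomp Require Import complex.

Set Implicit Arguments.
Unset Strict Implicit.
Unset Printing Implicit Defensive.

Import Order.TTheory GRing.Theory Num.Theory.
Import numFieldNormedType.Exports.

Local Open Scope classical_set_scope.
Local Open Scope ring_scope.
Local Open Scope complex_scope.

Section Operators.
Variables (R : realType) (H : completeNormedModType R[i]).
Implicit Types (A B : H -> H) (f : R -> R).

Definition bounded_op A : Prop :=
  linear A /\ exists M : R, forall x, `|A x| <= M%:C * `|x|.

Definition is_opinv A B : Prop :=
  [/\ bounded_op B, A \o B = idfun & B \o A = idfun].

Definition opinv A : H -> H := xget 0 [set B | is_opinv A B].

Definition spectrum A : set R[i] :=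
  [set z | ~ exists B, is_opinv (A - z *: idfun) B].

Definition poly_op (p : {poly R}) A : H -> H :=
  \sum_(i < size p) (p`_i)%:C *: iter i A.

(* Continuous functional calculus of a self-adjoint operator, whose spectrum
   is real: f(A) is the norm limit of the p(A), for real polynomials p
   converging to f uniformly on the spectrum of A. *)
Definition is_fcalc f A B : Prop :=
  bounded_op B /\
  forall e : R, 0 < e -> exists p : {poly R},
    (forall r : R, spectrum A r%:C -> `|p.[r] - f r| <= e) /\
    (forall x, `|poly_op p A x - B x| <= e%:C * `|x|).

Definition fcalc f A : H -> H := xget 0 [set B | is_fcalc f A B].

Definition oppow A (s : R) : H -> H := fcalc (fun x => x `^ s) A.

Definition oplog A : H -> H := fcalc (@ln R) A.

Definition geom (p : R) A B : H -> H :=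
  oppow A 2^-1
    \o oppow (oppow A (- 2^-1) \o B \o oppow A (- 2^-1)) p
    \o oppow A 2^-1.
End Operators.

Section PositiveOperators.
Variables (R : realType) (H : completeNormedModType R[i]).
Variable dot : {dot H for Num.conj}.
Implicit Types (A B X : H -> H).

Definition selfadjoint A : Prop := forall x y, dot (A x) y = dot x (A y).

(* 0 <= z in R[i] means that z is real and nonnegative. *)
Definition psd A : Prop := selfadjoint A /\ forall x, 0 <= dot (A x) x.

Definition loewner A B : Prop := psd (B - A).

Definition pos_op A : Prop :=
  [/\ bounded_op A, psd A & exists B, is_opinv A B].

Definition is_power_mean (p : R) k (lam : 'I_k -> R) (Xs : 'I_k -> H -> H) X :=
  pos_op X /\ X = \sum_(i < k) (lam i)%:C *: geom p X (Xs i).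

Definition is_karcher_mean k (lam : 'I_k -> R) (Xs : 'I_k -> H -> H) X :=
  pos_op X /\
  \sum_(i < k) (lam i)%:C *:
    oplog (oppow X 2^-1 \o opinv (Xs i) \o oppow X 2^-1) = 0.

Definition power_mean_pos (p : R) k (lam : 'I_k -> R) (Xs : 'I_k -> H -> H) :
    H -> H :=
  xget 0 [set X | is_power_mean p lam Xs X].

Definition karcher_mean k (lam : 'I_k -> R) (Xs : 'I_k -> H -> H) : H -> H :=
  xget 0 [set X | is_karcher_mean lam Xs X].

Definition power_mean (p : R) k (lam : 'I_k -> R) (Xs : 'I_k -> H -> H) :
    H -> H :=
  if 0 < p then power_mean_pos p lam Xs
  else if p < 0 then opinv (power_mean_pos (- p) lam (fun i => opinv (Xs i)))
  else karcher_mean lam Xs.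

(* P_p(1 - t, t; X, Y), with the convention for weights (1, 0) and (0, 1),
   which are not in the open simplex. *)
Definition power_mean2 (p t : R) X Y : H -> H :=
  if t == 0 then X
  else if t == 1 then Y
  else power_mean p (tnth [tuple 1 - t; t]) (tnth [tuple X; Y]).

Definition scalar_power_mean (p : R) k (lam a : 'I_k -> R) : R :=
  if p == 0 then \prod_(i < k) a i `^ lam i
  else (\sum_(i < k) lam i * a i `^ p) `^ p^-1.

Definition prob_vector n (w : 'I_n -> R) : Prop :=
  (forall i, 0 < w i) /\ \sum_(i < n) w i = 1.

(* G n is a map from Delta_n x P^n to P; its values at other arguments are
   unconstrained. *)
Record ordered_mean (G : forall n, ('I_n -> R) -> ('I_n -> H -> H) -> H -> H) :
    Prop := OrderedMean {
  ordered_mean_pos : forall n (w : 'I_n -> R) (A : 'I_n -> H -> H),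
    prob_vector w -> (forall i, pos_op (A i)) -> pos_op (G n w A) ;
  ordered_mean_homogeneous :
    forall n (w : 'I_n -> R) (A : 'I_n -> H -> H) (a : R),
    prob_vector w -> (forall i, pos_op (A i)) -> 0 < a ->
    G n w (fun i => a%:C *: A i) = a%:C *: G n w A ;
  ordered_mean_monotone : forall n (w : 'I_n -> R) (A B : 'I_n -> H -> H),
    prob_vector w -> (forall i, pos_op (A i)) -> (forall i, pos_op (B i)) ->
    (forall i, loewner (B i) (A i)) ->
    loewner (G n w B) (G n w A) ;
  ordered_mean_concave :
    forall n (w : 'I_n -> R) (A B : 'I_n -> H -> H) (s : R),
    prob_vector w -> (forall i, pos_op (A i)) -> (forall i, pos_op (B i)) ->
    0 <= s <= 1 ->
    loewner ((1 - s)%:C *: G n w A + s%:C *: G n w B)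
            (G n w (fun i => (1 - s)%:C *: A i + s%:C *: B i)) ;
  ordered_mean_bounds : forall n (w : 'I_n -> R) (A : 'I_n -> H -> H),
    prob_vector w -> (forall i, pos_op (A i)) ->
    loewner (opinv (\sum_(i < n) (w i)%:C *: opinv (A i))) (G n w A) /\
    loewner (G n w A) (\sum_(i < n) (w i)%:C *: A i) }.

Definition param_mean (G : forall n, ('I_n -> R) -> ('I_n -> H -> H) -> H -> H)
    (mu : R) n (w : 'I_n -> R) (A : 'I_n -> H -> H) : H -> H :=
  G n w (fun i => A i + mu%:C *: idfun) - mu%:C *: idfun.

End PositiveOperators.

(* Main.v *)
Require Import Defs.
From mathcomp Require Import all_boot all_order all_algebra.
From mathcomp Require Import all_classical all_reals all_analysis.
From mathcomp Require Import complex.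
From mathcomp Require Import ring lra.

(** By (P1) and (P3) an ordered mean is superadditive, and by (P4) it maps
(d I, ..., d I) above d I; hence G^a is nondecreasing and concave in a.
Write A_t for the weighted arithmetic mean. Kantorovich's inequality gives
P_p(mu, nu) >= P_{-1}(mu, nu) >= A_t(mu / K, nu / K), so that
G^{P_p(mu, nu)} >= (1 - t) G^{mu / K} + t G^{nu / K}. It remains to see that
an operator power mean is below the arithmetic mean. Conjugating its defining
equation by the square root of the solution reduces this to the scalar
inequalities x^p <= 1 - p + p x, ln x >= 1 - 1 / x and
x^q >= 1 + q - q / x, which the functional calculus transfers to operators. *)

Set Implicit Arguments.
Unset Strict Implicit.
Unset Printing Implicit Defensive.

Import Order.TTheory GRing.Theory Num.Theory.
Import numFieldNormedType.Exports.

Local Open Scope ring_scope.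
Local Open Scope complex_scope.

(** * Scalar inequalities and polynomial approximation *)

Section Scalars.
Variable R : realType.
Implicit Types (x y a b c d e L p q : R) (f : R -> R).

(** The operators [geom], [oppow] and [oplog] are chosen limits of polynomials in an operator, so
    before a scalar inequality can be transferred the calculus must be shown to exist, to be unique
    and to preserve order. Existence rests on uniform polynomial approximation over an interval
    containing the spectrum; coercivity keeps that interval away from 0, where ln and powers would
    cease to be Lipschitz. Order rests on one fact: a real polynomial that is nonnegative on the
    spectrum of a self-adjoint A has a nonnegative quadratic form at A. Operator inequalities are
    then handled at a fixed vector, as inequalities between real numbers.

    The three scalar bounds are tangents at x = 1, affine in x or in 1 / x. That form is what
    conjugation by a root of the solution M undoes exactly: 1 becomes M, and x or 1 / x becomes one
    of the given operators or its inverse. For p < 0 the mean is the inverse of a solution N, and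
    bounding an inverse from above calls for a lower bound on the terms of the equation of N; this
    is why x^q is bounded below, and through 1 / x. *)

Lemma ln_le_subr1 x : 0 < x -> ln x <= x - 1.
Proof.
move=> x0; have := @le_ln1Dx R (x - 1).
by rewrite [1 + _]addrC subrK; apply; rewrite ltrBrDr addNr.
Qed.

Lemma ln_ge_1BV x : 0 < x -> 1 - x^-1 <= ln x.
Proof.
move=> x0; have := ln_le_subr1 (x := x^-1); rewrite lnV ?posrE// invr_gt0.
by move=> /(_ x0); lra.
Qed.

Lemma powR_expR x p : 0 < x -> x `^ p = expR (p * ln x).
Proof. by move=> x0; rewrite /powR gt_eqF. Qed.

(** From x^q = exp (q ln x) >= 1 + q ln x and ln x >= 1 - 1 / x. *)
Lemma powR_ge_inv x q : 0 < x -> 0 <= q -> 1 + q - q * x^-1 <= x `^ q.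
Proof.
move=> x0 q0; rewrite powR_expR//; apply: le_trans (expR_ge1Dx _).
have := ler_wpM2l q0 (ln_ge_1BV x0); lra.
Qed.

(** Weighted AM-GM for x and 1. With m their weighted mean, ln u <= u - 1 is applied to x / m and to
    1 / m; the weighted sum of the right-hand sides is m / m - 1 = 0, which leaves p ln x <= ln
    m. *)
Lemma powR_le_lin x p : 0 < x -> 0 <= p <= 1 -> x `^ p <= 1 - p + p * x.
Proof.
move=> x0 /andP[p0 p1]; set m := 1 - p + p * x.
have m0 : 0 < m.
  have [pE|pn0] := eqVneq p 1; first by rewrite /m pE; lra.
  have : 0 <= p * x by rewrite mulr_ge0// ltW.
  have : p < 1 by rewrite lt_neqAle pn0.
  by rewrite /m; lra.
rewrite powR_expR// -[leRHS]lnK ?posrE// ler_expR.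
have h1 : ln (x / m) <= x / m - 1 by rewrite ln_le_subr1// divr_gt0.
have h2 : ln (1 / m) <= 1 / m - 1 by rewrite ln_le_subr1// divr_gt0.
move: h1 h2; rewrite !ln_div ?posrE// ln1.
move=> /(ler_wpM2l p0) h1 /(ler_wpM2l (_ : 0 <= 1 - p)) h2.
have {h2}h2 := h2 ltac:(by rewrite subr_ge0).
have : p * (x / m - 1) + (1 - p) * (1 / m - 1) = (1 - p + p * x) / m - 1.
  by field; rewrite gt_eqF.
rewrite -/m divff ?gt_eqF// subrr; lra.
Qed.

(** * Lipschitz functions and their uniform approximation by polynomials *)

Definition lipschitz_itv (a b L : R) f :=
  forall x y, a <= x <= b -> a <= y <= b -> `|f x - f y| <= L * `|x - y|.

Lemma lipschitz_ln a b : 0 < a -> lipschitz_itv a b a^-1 (@ln R).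
Proof.
move=> a0.
suff h x y : a <= x -> a <= y -> ln x - ln y <= a^-1 * `|x - y|.
  move=> x y /andP[ax _] /andP[ay _]; rewrite ler_norml h// andbT.
  by rewrite lerNl opprB distrC h.
move=> ax ay; have x0 := lt_le_trans a0 ax; have y0 := lt_le_trans a0 ay.
rewrite -ln_div ?posrE//; apply: le_trans (ln_le_subr1 (divr_gt0 x0 y0)) _.
have -> : x / y - 1 = y^-1 * (x - y) by field; rewrite gt_eqF.
apply: (@le_trans _ _ (y^-1 * `|x - y|)).
  by rewrite ler_wpM2l ?ler_norm// invr_ge0 ltW.
by rewrite ler_wpM2r// lef_pV2 ?posrE.
Qed.

(** Writing x^p = exp (u x) with u = p ln, convexity of exp gives exp (u x) - exp (u y) <= exp (u x)
    (u x - u y). The first factor is at most exp M, since ln z lies between ln a and ln b, and u is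
    Lipschitz with constant |p| / a. *)
Lemma lipschitz_powR a b p : 0 < a -> exists L, lipschitz_itv a b L (fun x => x `^ p).
Proof.
move=> a0; have [ab|ba] := leP a b; last first.
  by exists 0 => x y /andP[ax xb]; move: (le_lt_trans (le_trans ax xb) ba); rewrite ltxx.
have b0 := lt_le_trans a0 ab.
pose u z := p * ln z; pose M := `|p| * (`|ln a| + `|ln b|).
have uM z : a <= z <= b -> u z <= M.
  move=> /andP[az zb]; apply: le_trans (ler_norm _) _; rewrite normrM ler_wpM2l//.
  have z0 := lt_le_trans a0 az.
  have h1 : ln a <= ln z by rewrite ler_ln.
  have h2 : ln z <= ln b by rewrite ler_ln.
  have := ler_norm (ln b); have := lerNnormlW (lexx `|ln a|).
  have := normr_ge0 (ln a); have := normr_ge0 (ln b).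
  rewrite ler_norml; lra.
exists (expR M * (`|p| * a^-1)).
suff h x y : a <= x <= b -> a <= y <= b ->
    x `^ p - y `^ p <= expR M * (`|p| * a^-1) * `|x - y|.
  move=> x y xI yI; rewrite ler_norml h// andbT.
  by rewrite lerNl opprB distrC h.
move=> xI yI; have /andP[ax _] := xI; have /andP[ay _] := yI.
rewrite !powR_expR ?(lt_le_trans a0)//.
have h1 : expR (u x) - expR (u y) <= expR (u x) * (u x - u y).
  have -> : u y = u x + (u y - u x) by lra.
  rewrite expRD; have := ler_wpM2l (expR_ge0 (u x)) (expR_ge1Dx (u y - u x)).
  lra.
apply: le_trans h1 _; apply: (@le_trans _ _ (expR (u x) * `|u x - u y|)).
  by rewrite ler_wpM2l ?expR_ge0 ?ler_norm.
rewrite -mulrA ler_pM ?expR_ge0 ?ler_expR ?uM// /u -mulrBr normrM -mulrA.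
by rewrite ler_wpM2l//; apply: lipschitz_ln xI yI.
Qed.

(* The Bernstein polynomial \sum_k 'C(n, k) h k 'X^k (1 - 'X)^(n - k), by
   Pascal's rule, so that its moments follow by induction. *)
Fixpoint bernstein (n : nat) (h : nat -> R) : {poly R} :=
  if n is m.+1 then
    'X * bernstein m (fun k => h k.+1) + (1 - 'X) * bernstein m h
  else (h 0)%:P.

Lemma bernsteinS n h y : (bernstein n.+1 h).[y] =
  y * (bernstein n (fun k => h k.+1)).[y] + (1 - y) * (bernstein n h).[y].
Proof. by rewrite /= !hornerE. Qed.

Lemma bernstein_le n (h g : nat -> R) y : 0 <= y <= 1 ->
  (forall k, (k <= n)%N -> h k <= g k) -> (bernstein n h).[y] <= (bernstein n g).[y].
Proof.
move=> /andP[y0 y1]; elim: n h g => [|n IH] h g hg; first by rewrite /= !hornerE hg.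
rewrite !bernsteinS lerD// ler_wpM2l ?subr_ge0// IH// => k kn; apply: hg => //.
exact: leqW.
Qed.

Lemma bernstein_affine n (h : nat -> R) c d y :
  (bernstein n (fun k => c + d * h k)).[y] = c + d * (bernstein n h).[y].
Proof.
elim: n h => [|n IH] h; first by rewrite /= !hornerE.
by rewrite !bernsteinS !IH; ring.
Qed.

(** The recursion replaces k by k + 1, which amounts to replacing c by c + 1; the induction
    therefore runs over all c. At c = - n y this is the variance n y (1 - y) of the binomial law. *)
Lemma bernstein_variance n c y :
  (bernstein n (fun k => (k%:R + c) ^+ 2)).[y] =
  (n%:R * y + c) ^+ 2 + n%:R * y * (1 - y).
Proof.
elim: n c => [|n IH] c; first by rewrite /= !hornerE.
rewrite bernsteinS IH.
have -> : (fun k => (k.+1%:R + c) ^+ 2) = (fun k : nat => (k%:R + (c + 1)) ^+ 2).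
  by apply/funext => k; rewrite -natr1; congr (_ ^+ 2); ring.
by rewrite IH -natr1; ring.
Qed.

(** Chebyshev's argument without splitting the sum: f is squeezed at the nodes between f y - L g and
    f y + L g with g quadratic in k, and [bernstein] is monotone with known second moment. The free
    scale d balances the two error terms. *)
Lemma bernstein_approx f L d n y : 0 <= L -> 0 < d -> (0 < n)%N ->
  lipschitz_itv 0 1 L f -> 0 <= y <= 1 ->
  `|(bernstein n (fun k => f (k%:R / n%:R))).[y] - f y| <= L * (d + (n%:R * d)^-1).
Proof.
move=> L0 d0 n0 fL yI; have n0' : (0 : R) < n%:R by rewrite ltr0n.
have kI k : (k <= n)%N -> 0 <= (k%:R / n%:R : R) <= 1.
  by move=> kn; rewrite divr_ge0 ?ler0n//= ler_pdivrMr// mul1r ler_nat.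
(* |u| <= d + u^2 / d *)
pose g (k : nat) := d + (d * n%:R ^+ 2)^-1 * (k%:R + - (n%:R * y)) ^+ 2.
have hg k : (k <= n)%N -> `|f (k%:R / n%:R) - f y| <= L * g k.
  move=> kn; apply: le_trans (fL _ _ (kI _ kn) yI) _; rewrite ler_wpM2l//.
  set u := _ - _; have -> : g k = d + d^-1 * u ^+ 2.
    by rewrite /g /u; field; rewrite !gt_eqF.
  rewrite -[u ^+ 2]real_normK ?num_real//; set v := `|u|.
  have v0 : 0 <= v by rewrite normr_ge0.
  have [vd|dv] := leP v d.
    by rewrite ler_wpDr// mulr_ge0 ?invr_ge0 ?sqr_ge0// ltW.
  rewrite ler_wpDl ?(ltW d0)// ler_pdivlMl// expr2 ler_wpM2r// ltW//.
have gE : (bernstein n g).[y] <= d + (n%:R * d)^-1.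
  rewrite /g bernstein_affine bernstein_variance subrr expr0n/= add0r lerD2l.
  have -> : (d * n%:R ^+ 2)^-1 * (n%:R * y * (1 - y)) = (n%:R * d)^-1 * (y * (1 - y)).
    by field; rewrite !gt_eqF.
  rewrite ler_piMr ?invr_ge0 ?mulr_ge0 ?(ltW d0)// ?(ltW n0')//.
  by case/andP: yI => y0 y1; nra.
have gL := ler_wpM2l L0 gE; clearbody g; clear gE.
have lo : (bernstein n (fun k => f y + (- L) * g k)).[y] <=
    (bernstein n (fun k => f (k%:R / n%:R))).[y].
  apply: bernstein_le => // k /hg /=; rewrite ler_norml => /andP[].
  by rewrite ?mulNr => *; lra.
have up : (bernstein n (fun k => f (k%:R / n%:R))).[y] <=
    (bernstein n (fun k => f y + L * g k)).[y].
  apply: bernstein_le => // k /hg /=; rewrite ler_norml => /andP[].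
  by rewrite ?mulNr => *; lra.
move: lo up; rewrite !bernstein_affine ler_norml => lo up.
by apply/andP; split; move: lo up gL; move: (bernstein _ _).[y] (bernstein _ _).[y] => u v; lra.
Qed.

Lemma lipschitz_poly_approx f a b L e : lipschitz_itv a b L f -> 0 < e ->
  exists p : {poly R}, forall x, a <= x <= b -> `|p.[x] - f x| <= e.
Proof.
move=> fL e0; have [ab|ba] := ltP a b; last first.
  (* The interval is empty or reduced to the point a. *)
  exists (f a)%:P => x /andP[ax xb]; rewrite hornerC.
  have -> : x = a by apply/eqP; rewrite eq_le ax (le_trans xb ba).
  by rewrite subrr normr0 ltW.
have ba0 : 0 < b - a by rewrite subr_gt0.
pose L' := `|L| * (b - a); have L'0 : 0 <= L' by rewrite mulr_ge0// ltW.
pose g y := f (a + (b - a) * y).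
have gI y : 0 <= y <= 1 -> a <= a + (b - a) * y <= b.
  by move=> /andP[y0 y1]; apply/andP; split; nra.
have gL : lipschitz_itv 0 1 L' g.
  move=> x y xI yI; apply: le_trans (fL _ _ (gI _ xI) (gI _ yI)) _.
  have -> : a + (b - a) * x - (a + (b - a) * y) = (b - a) * (x - y) by ring.
  rewrite normrM (gtr0_norm ba0) mulrA ler_wpM2r// ler_wpM2r ?ler_norm//.
  exact: ltW.
(* The error L' (d + 1 / (n d)) is at most 2 L' d <= e once n >= 1 / d^2; adding 1 to L' keeps the
   denominator positive when L' = 0. *)
pose d := e / (2 * (L' + 1)).
have L1 : 0 < L' + 1 by lra.
have d0 : 0 < d by rewrite divr_gt0// mulr_gt0.
pose n := (Num.bound (d^-1 ^+ 2)).+1.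
have nd : (n%:R * d)^-1 <= d.
  have h : d^-1 ^+ 2 <= n%:R.
    have := archi_boundP (sqr_ge0 d^-1); rewrite /n -natr1; lra.
  rewrite invfM mulrC ler_pdivrMl// -expr2 -[leRHS]invrK.
  rewrite lef_pV2 ?posrE ?invr_gt0 ?exprn_gt0 ?ltr0n// -exprVn.
  exact: h.
exists (bernstein n (fun k => g (k%:R / n%:R)) \Po ((b - a)^-1 *: ('X - a%:P))).
move=> x /andP[ax xb]; rewrite horner_comp hornerZ hornerXsubC.
set y := (b - a)^-1 * (x - a).
have yI : 0 <= y <= 1.
  by rewrite mulr_ge0 ?invr_ge0 ?subr_ge0 ?(ltW ab)//= ler_pdivrMl// mulr1 lerB.
have -> : f x = g y.
  by congr f; rewrite /y; field; rewrite gt_eqF.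
apply: le_trans (bernstein_approx L'0 d0 (ltn0Sn _) gL yI) _.
apply: (@le_trans _ _ (L' * (d + d))); first by rewrite ler_wpM2l// lerD2l.
have -> : L' * (d + d) = e * (L' / (L' + 1)) by rewrite /d; field; rewrite gt_eqF.
by rewrite ler_piMr ?(ltW e0)// ler_pdivrMr// mul1r; lra.
Qed.

End Scalars.

(** * Hilbert space operators *)

Section RealForm.
Local Open Scope classical_set_scope.
Local Open Scope ring_scope.
Variables (R : realType) (H : completeNormedModType R[i]).
Variable dot : {dot H for Num.conj}.
Implicit Types (x y z : H) (a b c e M : R).

(** Norm and form take values in R[i]; their real parts bring all estimates into the ordered field
    R. Nothing is lost for the form, because the imaginary part of [dot x y] is
    [rdot x ('i *: y)]. *)
Definition rnorm x : R := complex.Re `|x|.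
Definition rdot x y : R := complex.Re (dot x y).

Lemma rnormE x : `|x| = (rnorm x)%:C.
Proof. by rewrite /rnorm RRe_real// normr_real. Qed.

Lemma rnorm_ge0 x : 0 <= rnorm x.
Proof. by rewrite -ler0c -rnormE normr_ge0. Qed.

Lemma rnorm_eq0 x : rnorm x = 0 -> x = 0.
Proof. by move=> x0; apply/eqP; rewrite -normr_eq0 rnormE x0. Qed.

Lemma rnorm0 : rnorm 0 = 0.
Proof. by rewrite /rnorm normr0. Qed.

Lemma rnormN x : rnorm (- x) = rnorm x.
Proof. by rewrite /rnorm normrN. Qed.

Lemma rnormD x y : rnorm (x + y) <= rnorm x + rnorm y.
Proof. by rewrite -lecR rmorphD/= -!rnormE ler_normD. Qed.

Lemma rnorm_distC x y : rnorm (x - y) = rnorm (y - x).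
Proof. by rewrite -rnormN opprB. Qed.

Lemma rnorm_dist_triangle y x z : rnorm (x - z) <= rnorm (x - y) + rnorm (y - z).
Proof. by rewrite -[x - z](subrKA y) rnormD. Qed.

Lemma rnormZ (w : R[i]) x : rnorm (w *: x) = complex.Re `|w| * rnorm x.
Proof.
apply: (@complexI R).
by rewrite rmorphM/= -!rnormE normrZ.
Qed.

Lemma rnormZr a x : rnorm (a%:C *: x) = `|a| * rnorm x.
Proof. by rewrite rnormZ normc_def/= expr0n/= addr0 sqrtr_sqr. Qed.

Lemma rnorm_le0 C x : (forall e, 0 < e -> rnorm x <= C * e) -> x = 0.
Proof.
move=> h; apply: rnorm_eq0; apply/eqP; rewrite eq_le rnorm_ge0 andbT.
apply/ler_addgt0Pr => e e0; rewrite add0r.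
have C0 : 0 < `|C| + 1 by rewrite ltr_wpDl.
apply: le_trans (h (e / (`|C| + 1)) _) _; first exact: divr_gt0.
rewrite mulrCA ler_piMr ?(ltW e0)// ler_pdivrMr// mul1r.
by have := ler_norm C; lra.
Qed.

Lemma complete_rnorm (u : nat -> H) :
  (forall e, 0 < e -> exists N, forall n, (N <= n)%N -> rnorm (u n - u N) <= e) ->
  exists l, forall e, 0 < e ->
    exists N, forall n, (N <= n)%N -> rnorm (u n - l) <= e.
Proof.
move=> cu; have : cvg (u @ \oo).
  apply: cauchy_cvg; apply: cauchy_exP => eps eps0.
  have epsE : eps = (complex.Re eps)%:C by rewrite RRe_real// gtr0_real.
  have e0 : 0 < complex.Re eps by rewrite -ltcR -epsE.
  have [N hN] := cu _ (divr_gt0 e0 (ltr0Sn _ 1)).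
  exists (u N); exists N => // n /= Nn; rewrite -ball_normE/= rnormE epsE ltcR.
  rewrite rnorm_distC; apply: le_lt_trans (hN _ Nn) _; lra.
move=> /cvg_ex[l ul]; exists l => e e0.
have := (@cvgrPdist_le _ _ _ _ _ u l).1 ul e%:C; rewrite ltcR => /(_ _ e0)[N _ hN].
by exists N => n Nn; have := hN _ Nn; rewrite /= rnormE lecR rnorm_distC.
Qed.

Lemma geometric_complete (u : nat -> H) k D : 0 <= k < 1 ->
  (forall n, rnorm (u n.+1 - u n) <= k ^+ n * D) ->
  exists l, forall e, 0 < e ->
    exists N, forall n, (N <= n)%N -> rnorm (u n - l) <= e.
Proof.
move=> /andP[k0 k1] uk; apply: complete_rnorm => e e0.
have D0 : 0 <= D by have := uk 0; rewrite expr0 mul1r; apply: le_trans; exact: rnorm_ge0.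
(* The telescoped geometric sum, multiplied by 1 - k so that the induction involves no division. *)
have S N m : (1 - k) * rnorm (u (N + m)%N - u N) <= k ^+ N * (1 - k ^+ m) * D.
  elim: m => [|m IH]; first by rewrite addn0 !subrr rnorm0 mulr0 mulr0 mul0r.
  rewrite addnS; have := ler_wpM2l (_ : 0 <= 1 - k)
    (rnorm_dist_triangle (u (N + m)%N) (u (N + m).+1) (u N)).
  rewrite subr_ge0 (ltW k1) => /(_ isT)/le_trans; apply.
  have := ler_wpM2l (_ : 0 <= 1 - k) (uk (N + m)%N).
  rewrite subr_ge0 (ltW k1) => /(_ isT); rewrite exprD exprS; move: IH.
  by rewrite mulrDr; move: (k ^+ N) (k ^+ m) => p q; lra.
have k1' : 0 < 1 - k by rewrite subr_gt0.
have e1 : 0 < e * (1 - k) / (D + 1) by rewrite divr_gt0 ?mulr_gt0// ltr_wpDl.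
have : (fun n => k ^+ n : R) @ \oo --> (0 : R) by apply: cvg_expr; rewrite ger0_norm.
move=> /cvgrPdist_le/(_ _ e1)[N _ /(_ N (leqnn N))/=].
rewrite sub0r normrN ger0_norm ?exprn_ge0// ler_pdivlMr ?ltr_wpDl// => hN.
exists N => n Nn; rewrite -(subnKC Nn) -(ler_pM2l k1').
apply: le_trans (S _ _) _; rewrite [leRHS]mulrC; apply: le_trans hN.
have q0 : 0 <= k ^+ (n - N) by rewrite exprn_ge0.
have p0 : 0 <= k ^+ N by rewrite exprn_ge0.
rewrite -mulrA ler_wpM2l//; nra.
Qed.

Hypothesis hdot : forall x, `|x| ^+ 2 = dot x x.

Lemma rdotxx x : rdot x x = rnorm x ^+ 2.
Proof. by rewrite /rdot -hdot rnormE -rmorphXn. Qed.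

Lemma rdotC x y : rdot x y = rdot y x.
Proof.
rewrite /rdot [dot x y]hermC expr0 mul1r.
have -> (w : R[i]) : complex.Re (Num.conj w) = complex.Re w by case: w.
by [].
Qed.

Lemma rdotDl x y z : rdot (x + y) z = rdot x z + rdot y z.
Proof. by rewrite /rdot linearDl raddfD. Qed.

Lemma rdotNl x y : rdot (- x) y = - rdot x y.
Proof. by rewrite /rdot linearNl raddfN. Qed.

Lemma rdotZl a x y : rdot (a%:C *: x) y = a * rdot x y.
Proof. by rewrite /rdot linearZl_LR/=; case: (dot x y) => u v /=; rewrite mul0r subr0. Qed.

Lemma rdot0l y : rdot 0 y = 0.
Proof. by rewrite /rdot linear0l. Qed.

Lemma rdotBl x y z : rdot (x - y) z = rdot x z - rdot y z.
Proof. by rewrite rdotDl rdotNl. Qed.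

Lemma rdotDr x y z : rdot x (y + z) = rdot x y + rdot x z.
Proof. by rewrite rdotC rdotDl !(rdotC x). Qed.

Lemma rdotNr x y : rdot x (- y) = - rdot x y.
Proof. by rewrite rdotC rdotNl (rdotC x). Qed.

Lemma rdotZr a x y : rdot x (a%:C *: y) = a * rdot x y.
Proof. by rewrite rdotC rdotZl rdotC. Qed.

Lemma quadratic_ge0_discr a b c : 0 <= c ->
  (forall r, 0 <= a + 2 * b * r + c * r ^+ 2) -> b ^+ 2 <= a * c.
Proof.
rewrite le_eqVlt => /predU1P[<-|c0] h.
  have [->|b0] := eqVneq b 0; first by rewrite expr0n mulr0.
  (* With c = 0 the polynomial is affine in r and takes the value -1 here, so b must vanish. For c >
     0 the test point is the minimiser - b / c. *)
  have := h (- (a + 1) / (2 * b)).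
  have -> : a + 2 * b * (- (a + 1) / (2 * b)) + 0 * (- (a + 1) / (2 * b)) ^+ 2 = -1.
    by field.
  by lra.
have := h (- b / c).
have -> : a + 2 * b * (- b / c) + c * (- b / c) ^+ 2 = (a * c - b ^+ 2) / c.
  by field; rewrite gt_eqF.
by rewrite pmulr_lge0 ?invr_gt0// subr_ge0.
Qed.

Lemma rdot_le x y : `|rdot x y| <= rnorm x * rnorm y.
Proof.
rewrite -[leRHS]ger0_norm ?mulr_ge0 ?rnorm_ge0// -ler_sqr ?nnegrE ?normr_ge0//.
rewrite !real_normK ?num_real// exprMn -!rdotxx.
apply: quadratic_ge0_discr => [|r]; first by rewrite rdotxx sqr_ge0.
have : 0 <= rdot (x + r%:C *: y) (x + r%:C *: y) by rewrite rdotxx sqr_ge0.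
rewrite !(rdotDl, rdotDr, rdotZl, rdotZr) (rdotC y x); lra.
Qed.

End RealForm.

(** * Bounded operators, their inverses and coercivity *)

Section Operators.
Variables (R : realType) (H : completeNormedModType R[i]).
Implicit Types (A B C T : H -> H) (x y z : H) (a b c e M : R) (w : R[i]).

Lemma Re_norm_ge0 w : 0 <= complex.Re `|w|.
Proof. by rewrite -ler0c RRe_real ?normr_real ?normr_ge0. Qed.

Lemma linear_opD A : linear A -> {morph A : x y / x + y}.
Proof. by move=> lA x y; have := lA 1 x y; rewrite !scale1r. Qed.

Lemma linear_op0 A : linear A -> A 0 = 0.
Proof. by move=> lA; apply: (addrI (A 0)); rewrite -linear_opD// !addr0. Qed.

Lemma linear_opZ A w : linear A -> {morph A : x / w *: x}.
Proof. by move=> lA x; have := lA w x 0; rewrite !addr0 linear_op0// addr0. Qed.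

Lemma linear_opB A : linear A -> {morph A : x y / x - y}.
Proof. by move=> lA x y; rewrite linear_opD// -(scaleN1r y) linear_opZ// scaleN1r. Qed.

Lemma bounded_opP A : bounded_op A <->
  linear A /\ exists2 M, 0 <= M & forall x, rnorm (A x) <= M * rnorm x.
Proof.
split=> -[lA [M]].
  move=> hM; split=> //; exists `|M| => // x.
  apply: le_trans (_ : M * rnorm x <= _); last by rewrite ler_wpM2r ?rnorm_ge0 ?ler_norm.
  by rewrite -lecR rmorphM/= -!rnormE.
by move=> M0 hM; split=> //; exists M => x; rewrite !rnormE -rmorphM lecR.
Qed.

Lemma bounded_linear A : bounded_op A -> linear A. Proof. by case. Qed.

Lemma bounded_op_id : bounded_op (idfun : H -> H).
Proof. by split=> //; exists 1 => x; rewrite mul1r. Qed.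

Lemma bounded_op_comp A B : bounded_op A -> bounded_op B -> bounded_op (A \o B).
Proof.
move=> /bounded_opP[lA [M M0 hM]] /bounded_opP[lB [N N0 hN]]; apply/bounded_opP.
split=> [w x y /=|]; first by rewrite linear_opD// linear_opZ// linear_opD// linear_opZ.
exists (M * N); first exact: mulr_ge0.
by move=> x /=; rewrite -mulrA (le_trans (hM _))// ler_wpM2l.
Qed.

Lemma bounded_opD A B : bounded_op A -> bounded_op B -> bounded_op (A + B).
Proof.
move=> /bounded_opP[lA [M M0 hM]] /bounded_opP[lB [N N0 hN]]; apply/bounded_opP.
split=> [w x y|].
  rewrite -![(A + B) _]/(A _ + B _) lA lB scalerDr.
  by rewrite -!addrA; congr (_ + _); rewrite addrCA.
exists (M + N); first exact: addr_ge0.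
by move=> x; rewrite mulrDl (le_trans (rnormD _ _))// lerD.
Qed.

Lemma bounded_opZ w A : bounded_op A -> bounded_op (w *: A).
Proof.
move=> /bounded_opP[lA [M M0 hM]]; apply/bounded_opP.
split=> [v x y|].
  by rewrite -![(w *: A) _]/(w *: A _) lA scalerDr !scalerA mulrC.
exists (complex.Re `|w| * M); first exact: mulr_ge0 (Re_norm_ge0 w) M0.
move=> x; rewrite -[(w *: A) _]/(w *: A _) rnormZ -mulrA ler_wpM2l//.
exact: Re_norm_ge0.
Qed.

Lemma bounded_opN A : bounded_op A -> bounded_op (- A).
Proof. by move=> bA; rewrite -scaleN1r; apply: bounded_opZ. Qed.

Lemma bounded_opB A B : bounded_op A -> bounded_op B -> bounded_op (A - B).
Proof. by move=> bA bB; apply: bounded_opD => //; apply: bounded_opN. Qed.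

Lemma bounded_op0 : bounded_op (0 : H -> H).
Proof. by rewrite -(scale0r idfun); apply: bounded_opZ; exact: bounded_op_id. Qed.

Lemma bounded_op_sum (I : Type) (r : seq I) (F : I -> H -> H) :
  (forall i, bounded_op (F i)) -> bounded_op (\sum_(i <- r) F i).
Proof.
move=> bF; elim: r => [|i r IH]; first by rewrite big_nil; exact: bounded_op0.
by rewrite big_cons; apply: bounded_opD.
Qed.

Lemma is_opinvK A B : is_opinv A B -> cancel B A.
Proof. by case=> _ AB _ x; rewrite -[A _]/((A \o B) x) AB. Qed.

Lemma is_opinvVK A B : is_opinv A B -> cancel A B.
Proof. by case=> _ _ BA x; rewrite -[B _]/((B \o A) x) BA. Qed.

Lemma is_opinvP A B : bounded_op B -> cancel B A -> cancel A B -> is_opinv A B.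
Proof. by move=> bB AB BA; split=> //; apply/funext => x /=; rewrite (AB, BA). Qed.

Lemma is_opinv_sym A B : bounded_op A -> is_opinv A B -> is_opinv B A.
Proof. by move=> bA [_ AB BA]. Qed.

Lemma is_opinv_unique A B C : is_opinv A B -> is_opinv A C -> B = C.
Proof.
move=> AB AC; apply/funext => x.
by rewrite -{1}(is_opinvK AC x) (is_opinvVK AB).
Qed.

Lemma opinvE A B : is_opinv A B -> opinv A = B.
Proof.
move=> AB; apply: xget_unique => // C iC; exact: is_opinv_unique iC AB.
Qed.

Lemma is_opinv_comp A A' B B' : is_opinv A A' -> is_opinv B B' ->
  is_opinv (A \o B) (B' \o A').
Proof.
move=> iA iB; apply: is_opinvP => [|x|x] /=.
- by apply: bounded_op_comp; [case: iB|case: iA].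
- by rewrite (is_opinvK iB) (is_opinvK iA).
- by rewrite (is_opinvVK iA) (is_opinvVK iB).
Qed.

Lemma is_opinvZ w A B : w != 0 -> is_opinv A B -> linear A ->
  is_opinv (w *: A) (w^-1 *: B).
Proof.
move=> w0 iA lA; have bB : bounded_op B by case: iA.
apply: is_opinvP => [|x|x]; first exact: bounded_opZ.
  by rewrite -[LHS]/(w *: A (w^-1 *: B x)) linear_opZ// scalerA divff// scale1r (is_opinvK iA).
rewrite -[LHS]/(w^-1 *: B (w *: A x)) (linear_opZ _ (bounded_linear bB)).
by rewrite scalerA mulVf// scale1r (is_opinvVK iA).
Qed.

Variable dot : {dot H for Num.conj}.
Hypothesis hdot : forall x, `|x| ^+ 2 = dot x x.
Local Notation "<| x , y |>" := (rdot dot x y) (at level 0).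

(* Lax-Milgram, by iterating x |-> x - rho (T x - y) *)
Lemma coercive_invertible T c : bounded_op T -> 0 < c ->
  (forall x, c * rnorm x ^+ 2 <= <| T x, x |>) -> exists B, is_opinv T B.
Proof.
move=> /bounded_opP[lT [M M0 hM]] c0 hc.
have Tinj x : T x = 0 -> x = 0.
  move=> Tx; apply: rnorm_eq0; apply/eqP; rewrite -sqrf_eq0 eq_le sqr_ge0 andbT.
  by have := hc x; rewrite Tx rdot0l pmulr_rle0.
have Tlow x : c * rnorm x <= rnorm (T x).
  have [x0|xn0] := eqVneq (rnorm x) 0; first by rewrite x0 mulr0 rnorm_ge0.
  have x0 : 0 < rnorm x by rewrite lt_neqAle eq_sym xn0 rnorm_ge0.
  rewrite -(ler_pM2r x0) -mulrA -expr2; apply: le_trans (hc x) _.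
  exact: le_trans (ler_norm _) (rdot_le hdot _ _).
(* M1 is a bound for T that is positive and at least c, so c / M1 <= 1. The step rho = c / M1^2
   minimises 1 - 2 rho c + rho^2 M1^2, the bound for the squared contraction factor; its minimum is
   k2. *)
pose M1 := M + c; have M10 : 0 < M1 by rewrite ltr_wpDl.
pose rho := c / M1 ^+ 2; have rho0 : 0 < rho by rewrite divr_gt0// exprn_gt0.
pose k2 := 1 - (c / M1) ^+ 2.
have cM : 0 < c / M1 <= 1.
  by rewrite divr_gt0//= ler_pdivrMr// mul1r /M1; lra.
have k20 : 0 <= k2 < 1.
  by move: cM => /andP[p0 p1]; rewrite /k2; apply/andP; split; nra.
have contr x : rnorm (x - rho%:C *: T x) <= Num.sqrt k2 * rnorm x.
  rewrite -[leRHS]ger0_norm ?mulr_ge0 ?rnorm_ge0 ?sqrtr_ge0//.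
  rewrite -[leLHS]ger0_norm ?rnorm_ge0// -ler_sqr ?nnegrE ?normr_ge0//.
  rewrite !real_normK ?num_real// exprMn sqr_sqrtr; last by case/andP: k20.
  rewrite -(rdotxx hdot) rdotBl !(rdotDr, rdotNr, rdotZl, rdotZr).
  rewrite (rdotC dot x) !(rdotxx hdot).
  have h1 := ler_wpM2l (ltW rho0) (hc x).
  have h2 : rho ^+ 2 * rnorm (T x) ^+ 2 <= rho ^+ 2 * (M1 ^+ 2 * rnorm x ^+ 2).
    rewrite ler_wpM2l ?sqr_ge0// -exprMn ler_sqr ?nnegrE ?mulr_ge0 ?rnorm_ge0 ?(ltW M10)//.
    apply: le_trans (hM x) _; rewrite ler_wpM2r ?rnorm_ge0// /M1; lra.
  have e1 : rho ^+ 2 * (M1 ^+ 2 * rnorm x ^+ 2) = (c / M1) ^+ 2 * rnorm x ^+ 2.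
    by rewrite /rho; field; rewrite gt_eqF.
  have e2 : rho * (c * rnorm x ^+ 2) = (c / M1) ^+ 2 * rnorm x ^+ 2.
    by rewrite /rho; field; rewrite gt_eqF.
  by rewrite /k2; move: h1 h2; rewrite e1 e2; move: ((c / M1) ^+ 2) => q; lra.
have k1 : 0 <= Num.sqrt k2 < 1.
  by rewrite sqrtr_ge0/= -sqrtr1 ltr_sqrt//; case/andP: k20.
have Tsurj y : exists x, T x = y.
  pose u := fix u n := if n is m.+1 then u m - rho%:C *: (T (u m) - y) else 0.
  have uS n : u n.+1 - u n = - (rho%:C *: (T (u n) - y)).
    by rewrite /= addrAC subrr add0r.
  have uk n : rnorm (u n.+1 - u n) <= Num.sqrt k2 ^+ n * rnorm (u 1%N - u 0%N).
    elim: n => [|n IH]; first by rewrite expr0 mul1r.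
    rewrite exprS -mulrA; apply: le_trans (ler_wpM2l (sqrtr_ge0 _) IH).
    have -> : u n.+2 - u n.+1 = (u n.+1 - u n) - rho%:C *: T (u n.+1 - u n).
      have Tu : T (u n.+1 - u n) = T (u n.+1) - T (u n) by exact: linear_opB.
      rewrite Tu uS [X in _ = X - _]uS; move: (T (u n.+1)) (T (u n)) => v w.
      by rewrite -opprD -scalerDr [w - y + _]addrC subrKA.
    exact: contr.
  have [l hl] := geometric_complete k1 uk; exists l; apply/eqP; rewrite -subr_eq0; apply/eqP.
  (* M accounts for T (l - u N). The residual T (u N) - y is, up to sign, (u N.+1 - u N) / rho, and
     both iterates lie within e of l: hence 2 / rho. *)
  apply: (@rnorm_le0 R H (M + 2 / rho)) => e e0; have [N hN] := hl _ e0.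
  have h1 := hN _ (leqnn N); have h2 := hN _ (leqnSn N).
  have -> : T l - y = T (l - u N) + (T (u N) - y) by rewrite (linear_opB lT) subrKA.
  apply: le_trans (rnormD _ _) _; rewrite mulrDl lerD//.
    by apply: le_trans (hM _) _; rewrite ler_wpM2l// rnorm_distC.
  rewrite mulrAC ler_pdivlMr// mulrC -[X in X * _](ger0_norm (ltW rho0)) -rnormZr -rnormN -uS.
  apply: le_trans (rnorm_dist_triangle l _ _) _.
  by rewrite mulr2n mulrDl !mul1r lerD// rnorm_distC.
(* A pointwise right inverse is enough: injectivity of T makes it linear and two-sided, and the
   lower bound on T bounds it by 1 / c. *)
have [B TB] := boolp.choice Tsurj.
have BT x : B (T x) = x.
  by apply/eqP; rewrite -subr_eq0; apply/eqP/Tinj; rewrite (linear_opB lT) TB subrr.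
exists B; apply: is_opinvP => //; apply/bounded_opP; split.
  move=> w x y; apply/eqP; rewrite -subr_eq0; apply/eqP/Tinj.
  by rewrite (linear_opB lT) (linear_opD lT) (linear_opZ _ lT) !TB subrr.
exists c^-1; first by rewrite invr_ge0 ltW.
by move=> x; rewrite ler_pdivlMl// -[in leRHS](TB x).
Qed.

End Operators.

(** * Self-adjoint operators and positivity on the spectrum *)

Section SelfAdjoint.
Local Open Scope classical_set_scope.
Local Open Scope ring_scope.
Variables (R : realType) (H : completeNormedModType R[i]).
Variable dot : {dot H for Num.conj}.
Hypothesis hdot : forall x : H, `|x| ^+ 2 = dot x x.
Implicit Types (A B C S T : H -> H) (x y : H) (a b c e M : R) (w z : R[i]).
Local Notation "<| x , y |>" := (rdot dot x y) (at level 0).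

Lemma Im_dot x y : complex.Im (dot x y) = <| x, 'i *: y |>.
Proof.
have -> : <| x, 'i *: y |> = complex.Re (conjc 'i * dot x y).
  by congr complex.Re; exact: linearZr_LR.
by case: (dot x y) => u v /=; rewrite mul0r mulN1r opprK add0r.
Qed.

Lemma selfadjoint_rdot A : selfadjoint dot A ->
  forall x y, <| A x, y |> = <| x, A y |>.
Proof. by move=> sA x y; rewrite /rdot sA. Qed.

(** Symmetry of the real form at y gives the real parts, and at 'i *: y the imaginary parts. *)
Lemma rdot_selfadjoint A : linear A ->
  (forall x y, <| A x, y |> = <| x, A y |>) -> selfadjoint dot A.
Proof.
move=> lA hA x y; have hR := hA x y; have hI := hA x ('i *: y).
move: hI; rewrite (linear_opZ _ lA) -!Im_dot; move: hR; rewrite /rdot.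
by case: (dot _ _) (dot _ _) => u v [u' v'] /= -> ->.
Qed.

Lemma selfadjoint_Im A x : selfadjoint dot A -> complex.Im (dot (A x) x) = 0.
Proof.
move=> sA; have : dot (A x) x = (-1) ^+ false * Num.conj (dot x (A x)) by rewrite hermC.
rewrite expr0 mul1r -sA; case: (dot _ _) => u v [] /= h; lra.
Qed.

Lemma psdP A : selfadjoint dot A -> (psd dot A <-> forall x, 0 <= <| A x, x |>).
Proof.
move=> sA; split=> [[_ pA] x|pA]; first by have := pA x; rewrite lecE => /andP[].
by split=> // x; rewrite lecE /= selfadjoint_Im// eqxx; exact: pA.
Qed.

Lemma psd_rdot A x : psd dot A -> 0 <= <| A x, x |>.
Proof. by move=> pA; have [sA _] := pA; move/(psdP sA): pA. Qed.

Lemma loewnerP A B : selfadjoint dot (B - A) ->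
  (loewner dot A B <-> forall x, <| A x, x |> <= <| B x, x |>).
Proof.
move=> sAB; rewrite /loewner psdP//; split=> h x; have := h x.
  by rewrite -[(B - A) x]/(B x - A x) rdotBl subr_ge0.
by rewrite -[(B - A) x]/(B x - A x) rdotBl subr_ge0.
Qed.

Lemma selfadjoint0 : selfadjoint dot 0.
Proof. by move=> x y; rewrite linear0l linear0r. Qed.

Lemma selfadjoint_id : selfadjoint dot idfun. Proof. by []. Qed.

Lemma selfadjointD A B : selfadjoint dot A -> selfadjoint dot B ->
  selfadjoint dot (A + B).
Proof. by move=> sA sB x y; rewrite -![(A + B) _]/(A _ + B _) linearDl linearDr/= sA sB. Qed.

Lemma selfadjointN A : selfadjoint dot A -> selfadjoint dot (- A).
Proof. by move=> sA x y; rewrite -![(- A) _]/(- A _) linearNl linearNr/= sA. Qed.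

Lemma selfadjointB A B : selfadjoint dot A -> selfadjoint dot B ->
  selfadjoint dot (A - B).
Proof. by move=> sA sB; apply: selfadjointD => //; apply: selfadjointN. Qed.

Lemma selfadjointZ a A : selfadjoint dot A -> selfadjoint dot (a%:C *: A).
Proof.
move=> sA x y; rewrite -![(a%:C *: A) _]/(a%:C *: A _) linearZl_LR linearZr_LR/= sA.
by rewrite -[Num.conj _]/(conjc a%:C) conjc_real.
Qed.

Lemma selfadjoint_iter A n : selfadjoint dot A -> selfadjoint dot (iter n A).
Proof. by move=> sA; elim: n => // n IH x y; rewrite iterS sA IH -iterSr. Qed.

Lemma selfadjoint_sum (I : Type) (r : seq I) (F : I -> H -> H) :
  (forall i, selfadjoint dot (F i)) -> selfadjoint dot (\sum_(i <- r) F i).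
Proof.
move=> sF; elim: r => [|i r IH]; first by rewrite big_nil; exact: selfadjoint0.
by rewrite big_cons; apply: selfadjointD.
Qed.

Lemma selfadjoint_opinv A B : selfadjoint dot A -> is_opinv A B ->
  selfadjoint dot B.
Proof.
by move=> sA iA x y; rewrite -{1}(is_opinvK iA y) -sA (is_opinvK iA).
Qed.

Lemma psd_cauchy_schwarz S x y : linear S -> psd dot S ->
  <| S x, y |> ^+ 2 <= <| S x, x |> * <| S y, y |>.
Proof.
move=> lS pS; have [sS _] := pS; apply: quadratic_ge0_discr; first exact: psd_rdot.
move=> r; have := psd_rdot (x + r%:C *: y) pS.
rewrite linear_opD// linear_opZ// !(rdotDl, rdotDr, rdotZl, rdotZr).
rewrite (selfadjoint_rdot sS y x) (rdotC dot y); lra.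
Qed.

(** A converse to [coercive_invertible]. Cauchy-Schwarz for the form of S, applied to x and S x,
    gives |S x|^2 <= L <S x, x>, where L bounds S; and |x| <= N |S x|, where N bounds the
    inverse. *)
Lemma psd_invertible_coercive S B : bounded_op S -> psd dot S -> is_opinv S B ->
  exists2 c, 0 < c & forall x, c * rnorm x ^+ 2 <= <| S x, x |>.
Proof.
move=> /bounded_opP[lS [L L0 hL]] pS iS.
have /bounded_opP[_ [N N0 hN]] : bounded_op B by case: iS.
have hS x : rnorm (S x) ^+ 2 <= L * <| S x, x |>.
  have p0 := psd_rdot x pS.
  have [->|n0] := eqVneq (rnorm (S x)) 0; first by rewrite expr0n mulr_ge0.
  have q0 : 0 < rnorm (S x) ^+ 2 by rewrite exprn_gt0// lt_neqAle eq_sym n0 rnorm_ge0.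
  rewrite -(ler_pM2r q0) -expr2 -{1}(rdotxx hdot).
  apply: le_trans (psd_cauchy_schwarz _ _ lS pS) _.
  rewrite [L * _]mulrC -mulrA ler_wpM2l//.
  apply: le_trans (ler_norm _) _; apply: le_trans (rdot_le hdot _ _) _.
  by rewrite expr2 mulrA ler_wpM2r ?rnorm_ge0.
have NL0 : 0 <= N ^+ 2 * L by rewrite mulr_ge0 ?sqr_ge0.
exists (N ^+ 2 * L + 1)^-1; first by rewrite invr_gt0; lra.
move=> x; rewrite ler_pdivrMl; last by lra.
have p0 := psd_rdot x pS.
apply: (@le_trans _ _ (N ^+ 2 * L * <| S x, x |>)); last by rewrite ler_wpM2r//; lra.
rewrite -mulrA; apply: le_trans (ler_wpM2l (sqr_ge0 N) (hS x)).
rewrite -exprMn ler_sqr ?nnegrE ?mulr_ge0 ?rnorm_ge0//.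
by rewrite -{1}(is_opinvVK iS x).
Qed.

(** Since <A x, x> is real, multiplying A - w by v = 'i Im w makes the real part of its form exactly
    (Im w)^2 |x|^2, so v (A - w) is coercive; the factor v is then moved into the inverse. *)
Lemma selfadjoint_nonreal_invertible A w : bounded_op A -> selfadjoint dot A ->
  complex.Im w != 0 -> exists B, is_opinv (A - w *: idfun) B.
Proof.
move=> bA sA w0; pose v := (complex.Im w)%:C * 'i.
have v0 : v != 0.
  apply: contra_neq w0 => /(congr1 (@complex.Im R)) /=.
  by rewrite mul0r addr0 mulr1.
have bT : bounded_op (A - w *: idfun).
  by apply: bounded_opB => //; apply: bounded_opZ; exact: bounded_op_id.
have [|||B iB] := @coercive_invertible R H dot hdot (v *: (A - w *: idfun)) (complex.Im w ^+ 2).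
- exact: bounded_opZ.
- by rewrite lt_neqAle eq_sym sqrf_eq0 w0 sqr_ge0.
- move=> x.
  have E : dot ((v *: (A - w *: idfun)) x) x = v * (dot (A x) x - w * `|x| ^+ 2).
    rewrite hdot -[(v *: _) x]/(v *: (A x - w *: x)) linearZl_LR; congr (_ * _).
    by rewrite linearBl; congr (_ - _); exact: linearZl_LR.
  rewrite /rdot E rnormE -rmorphXn; move: (selfadjoint_Im x sA); rewrite /v.
  case: (dot _ _) => p q /= ->; case: (w) => w1 w2 /=.
  by rewrite le_eqVlt; apply/orP; left; apply/eqP; ring.
exists (B \o ( *:%R v)); have bB : bounded_op B by case: iB.
have bv : bounded_op ( *:%R v : H -> H).
  by rewrite -[( *:%R v)]/(v *: (idfun : H -> H)); apply: bounded_opZ; exact: bounded_op_id.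
apply: is_opinvP => [|x /=|x /=]; first exact: bounded_op_comp.
  by apply: (scalerI v0); rewrite -[LHS]/((v *: (A - w *: idfun)) _) (is_opinvK iB).
by rewrite -[X in B X]/((v *: (A - w *: idfun)) x) (is_opinvVK iB).
Qed.

(** * Polynomials in an operator, and positivity on the spectrum *)

(** Complex coefficients are allowed because invertibility of p(A) is read off from the linear
    factors of p, which exist over R[i] but not always over R. *)
Definition cpoly_op (p : {poly R[i]}) A : H -> H :=
  fun x => \sum_(i < size p) p`_i *: iter i A x.

Lemma cpoly_opE n (p : {poly R[i]}) A x : (size p <= n)%N ->
  cpoly_op p A x = \sum_(i < n) p`_i *: iter i A x.
Proof.
move=> pn; rewrite /cpoly_op (big_ord_widen n (fun i => p`_i *: iter i A x))//.
rewrite [RHS](bigID (fun i : 'I_n => i < size p)%N)/= [X in _ + X]big1 ?addr0//.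
by move=> i; rewrite -leqNgt => pi; rewrite nth_default// scale0r.
Qed.

Lemma cpoly_opD (p q : {poly R[i]}) A x : cpoly_op (p + q) A x = cpoly_op p A x + cpoly_op q A x.
Proof.
pose n := maxn (size (p + q)) (maxn (size p) (size q)).
rewrite !(@cpoly_opE n) ?leq_max ?leqnn ?orbT//.
by rewrite -big_split; apply: eq_bigr => i _; rewrite coefD scalerDl.
Qed.

Lemma cpoly_opZ w (p : {poly R[i]}) A x : cpoly_op (w *: p) A x = w *: cpoly_op p A x.
Proof.
rewrite (@cpoly_opE (size p)) ?size_scale_leq// scaler_sumr.
by apply: eq_bigr => i _; rewrite coefZ scalerA.
Qed.

Lemma cpoly_opC w A x : cpoly_op w%:P A x = w *: x.
Proof. by rewrite (@cpoly_opE 1) ?size_polyC_leq1// big_ord1 coefC. Qed.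

Lemma cpoly_opMX (p : {poly R[i]}) A x : linear A -> cpoly_op (p * 'X) A x = A (cpoly_op p A x).
Proof.
move=> lA; rewrite (@cpoly_opE (size p).+1); last first.
  by have [->|p0] := eqVneq p 0; rewrite ?mul0r ?size_poly0// size_mulX.
rewrite big_ord_recl coefMX/= scale0r add0r /cpoly_op.
have Asum (I : Type) (r : seq I) (F : I -> H) : A (\sum_(i <- r) F i) = \sum_(i <- r) A (F i).
  by apply: big_morph; [exact: linear_opD|exact: linear_op0].
by rewrite Asum; apply: eq_bigr => i _; rewrite (linear_opZ _ lA) coefMX.
Qed.

Lemma cpoly_opM (p q : {poly R[i]}) A x : linear A ->
  cpoly_op (p * q) A x = cpoly_op p A (cpoly_op q A x).
Proof.
move=> lA; elim/poly_ind: p => [|p w IH].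
  by rewrite mul0r -polyC0 !cpoly_opC !scale0r.
rewrite mulrDl -mulrA [_ * q]mulrC mulrA !cpoly_opD !cpoly_opMX// IH.
by rewrite mul_polyC cpoly_opZ cpoly_opC.
Qed.

(** One half of the spectral mapping theorem: p(A) is the leading coefficient times a composition of
    operators A - z over the roots z of p. *)
Lemma cpoly_op_invertible (p : {poly R[i]}) A : bounded_op A -> p != 0 ->
  (forall z, root p z -> exists B, is_opinv (A - z *: idfun) B) ->
  exists B, is_opinv (cpoly_op p A) B.
Proof.
move=> bA p0 hp; have lA := bounded_linear bA.
have [r pE] := closed_field_poly_normal p.
have l0 : lead_coef p != 0 by rewrite lead_coef_eq0.
have {}hp z : z \in r -> exists B, is_opinv (A - z *: idfun) B.
  by move=> zr; apply: hp; rewrite pE rootZ// root_prod_XsubC.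
(* Linearity of the product is carried along because inverting its multiple by the leading
   coefficient uses it. *)
have [B [iB lB]] : exists B, is_opinv (cpoly_op (\prod_(z <- r) ('X - z%:P)) A) B /\
    linear (cpoly_op (\prod_(z <- r) ('X - z%:P)) A).
  elim: r hp {pE} => [_|z r IH hp].
    exists idfun; rewrite big_nil -polyC1.
    have -> : cpoly_op 1%:P A = idfun by apply/funext => x; rewrite cpoly_opC scale1r.
    by split=> //; apply: is_opinvP => //; exact: bounded_op_id.
  have [|B [iB lB]] := IH; first by move=> v vr; apply: hp; rewrite inE vr orbT.
  have [C iC] := hp z (mem_head _ _).
  have E : cpoly_op (\prod_(z <- z :: r) ('X - z%:P)) A =
      (A - z *: idfun) \o cpoly_op (\prod_(z <- r) ('X - z%:P)) A.
    apply/funext => x; rewrite big_cons cpoly_opM//= -polyCN cpoly_opD cpoly_opC.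
    by rewrite -['X]mul1r cpoly_opMX// -polyC1 cpoly_opC scale1r scaleNr.
  exists (B \o C); rewrite E; split; first exact: is_opinv_comp.
  move=> w x y; rewrite /= lB -![(A - _) _]/(A _ - _ *: _).
  by rewrite lA scalerDr scalerBr !scalerA [z * w]mulrC opprD addrACA.
have iB' := is_opinvZ l0 iB lB.
exists ((lead_coef p)^-1 *: B); rewrite [X in cpoly_op X]pE.
by have -> : cpoly_op (lead_coef p *: \prod_(z <- r) ('X - z%:P)) A =
   lead_coef p *: cpoly_op (\prod_(z <- r) ('X - z%:P)) A
   by apply/funext => x; rewrite cpoly_opZ.
Qed.

Lemma poly_opE (p : {poly R}) A :
  poly_op p A = cpoly_op (map_poly (real_complex R) p) A.
Proof.
apply/funext => x; rewrite /poly_op fct_sumE /cpoly_op size_map_poly.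
by apply: eq_bigr => i _; rewrite coef_map.
Qed.

Lemma poly_opD (p q : {poly R}) A : poly_op (p + q) A = poly_op p A + poly_op q A.
Proof. by apply/funext => x; rewrite !poly_opE rmorphD cpoly_opD -!poly_opE. Qed.

Lemma poly_opZ a (p : {poly R}) A : poly_op (a *: p) A = a%:C *: poly_op p A.
Proof. by apply/funext => x; rewrite !poly_opE map_polyZ/= cpoly_opZ -!poly_opE. Qed.

Lemma poly_opN (p : {poly R}) A : poly_op (- p) A = - poly_op p A.
Proof. by rewrite -scaleN1r poly_opZ rmorphN rmorph1 scaleN1r. Qed.

Lemma poly_opB (p q : {poly R}) A : poly_op (p - q) A = poly_op p A - poly_op q A.
Proof. by rewrite poly_opD poly_opN. Qed.

Lemma poly_opC a A : poly_op a%:P A = a%:C *: idfun.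
Proof. by apply/funext => x; rewrite !poly_opE map_polyC/= cpoly_opC. Qed.

Lemma poly_opX A : linear A -> poly_op 'X A = A.
Proof.
move=> lA; apply/funext => x; rewrite !poly_opE map_polyX/=.
by rewrite -['X]mul1r cpoly_opMX// -polyC1 cpoly_opC scale1r.
Qed.

Lemma poly_opM (p q : {poly R}) A : linear A -> poly_op (p * q) A = poly_op p A \o poly_op q A.
Proof.
by move=> lA; apply/funext => x; rewrite !poly_opE rmorphM/= cpoly_opM.
Qed.

Lemma bounded_poly_op (p : {poly R}) A : bounded_op A -> bounded_op (poly_op p A).
Proof.
move=> bA; apply: bounded_op_sum => i; apply: bounded_opZ.
by elim: (i : nat) => [|n IH]; [exact: bounded_op_id|exact: (bounded_op_comp bA IH)].
Qed.

Lemma selfadjoint_poly_op (p : {poly R}) A : selfadjoint dot A -> selfadjoint dot (poly_op p A).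
Proof.
by move=> sA; apply: selfadjoint_sum => i; apply: selfadjointZ; exact: selfadjoint_iter.
Qed.

(* If p(A) is not positive, its lowest Rayleigh quotient m < 0 makes p(A) - m
   singular, so by factoring p - m over C it has a root in the spectrum. *)
Lemma rdot_nonconstant_poly_op_ge0 (p : {poly R}) A : bounded_op A -> selfadjoint dot A ->
  (1 < size p)%N -> (forall r, spectrum A r%:C -> 0 <= p.[r]) ->
  forall x, 0 <= <| poly_op p A x, x |>.
Proof.
move=> bA sA p1 hp x0; have lA := bounded_linear bA.
have bT := bounded_poly_op p bA; have sT := selfadjoint_poly_op p sA.
rewrite leNgt; apply/negP => Tx0.
(* E collects the lower bounds of the Rayleigh quotient of p(A); its supremum m belongs to E, and x0
   forces m < 0. *)
pose E : set R := [set c | forall x, c * rnorm x ^+ 2 <= <| poly_op p A x, x |>].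
have nx0 : 0 < rnorm x0 ^+ 2.
  rewrite exprn_gt0// lt_neqAle rnorm_ge0 andbT eq_sym.
  apply/eqP => /rnorm_eq0 x00; move: Tx0.
  by rewrite x00 (linear_op0 (bounded_linear bT)) rdot0l ltxx.
have ubE x c : E c -> 0 < rnorm x ^+ 2 -> c <= <| poly_op p A x, x |> / rnorm x ^+ 2.
  by move=> Ec nx; rewrite ler_pdivlMr//; exact: Ec.
have supE : has_sup E.
  split; last by exists (<| poly_op p A x0, x0 |> / rnorm x0 ^+ 2) => c Ec; exact: ubE.
  have /bounded_opP[_ [M M0 hM]] := bT; exists (- M) => x.
  have := rdot_le hdot (poly_op p A x) x; rewrite ler_norml => /andP[h _].
  apply: le_trans h; rewrite mulNr lerN2 expr2 mulrA ler_wpM2r ?rnorm_ge0//.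
pose m := sup E.
have Em : E m.
  move=> x; have [n0|n0] := eqVneq (rnorm x) 0.
    by rewrite n0 expr0n mulr0 (rnorm_eq0 n0) (linear_op0 (bounded_linear bT)) rdot0l.
  have nx : 0 < rnorm x ^+ 2 by rewrite exprn_gt0// lt_neqAle eq_sym n0 rnorm_ge0.
  by rewrite -ler_pdivlMr//; apply: ge_sup; [case: supE|move=> c Ec; exact: ubE].
have m0 : m < 0.
  by rewrite ltNge; apply/negP => m0; have := Em x0; nra.
pose S := poly_op (p - m%:P) A.
have SE x : <| S x, x |> = <| poly_op p A x, x |> - m * rnorm x ^+ 2.
  rewrite /S poly_opB poly_opC -[(_ - _) x]/(poly_op p A x - m%:C *: x) rdotBl rdotZl.
  by rewrite (rdotxx hdot).
have bS : bounded_op S by exact: bounded_poly_op.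
have sS : selfadjoint dot S by exact: selfadjoint_poly_op.
have pS : psd dot S by apply/(psdP sS) => x; rewrite SE subr_ge0.
have [B iB] : exists B, is_opinv S B.
  rewrite /S poly_opE.
  have rN0 (r : R) : spectrum A r%:C -> (p - m%:P).[r] != 0.
    by move=> /hp pr; rewrite !hornerE gt_eqF//; lra.
  have hroot z : root (map_poly (real_complex R) (p - m%:P)) z ->
      exists B, is_opinv (A - z *: idfun) B.
    move=> rz; have [Imz|Imz] := eqVneq (complex.Im z) 0; last first.
      exact: selfadjoint_nonreal_invertible.
    have zE : z = (complex.Re z)%:C by case: z Imz {rz} => z1 z2 /= ->.
    apply: contrapT => sz; have : spectrum A (complex.Re z)%:C by rewrite -zE.
    move=> /rN0 /eqP; apply; apply: (@complexI R).
    by move: rz; rewrite zE /root horner_map => /eqP.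
  (* The polynomial p - m is nonzero because p is not constant. *)
  apply: cpoly_op_invertible => //; rewrite map_poly_eq0 subr_eq0.
  by apply: contraTneq p1 => ->; rewrite size_polyC -leqNgt leq_b1.
(* On the spectrum p >= 0 > m, so p(A) - m has come out invertible; being positive it is coercive,
   and the lower bound m can be raised by c against its choice as a supremum. *)
have [c c0 hc] := psd_invertible_coercive bS pS iB.
have : E (m + c).
  by move=> x; have := hc x; rewrite SE; lra.
by move=> /(ub_le_sup (proj2 supE)); rewrite -/m; lra.
Qed.

Lemma rdot_poly_op_ge0 (p : {poly R}) A : bounded_op A -> selfadjoint dot A ->
  (forall r, spectrum A r%:C -> 0 <= p.[r]) ->
  forall x, 0 <= <| poly_op p A x, x |>.
Proof.
move=> bA sA hp x; have [p1|p1] := ltnP 1 (size p).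
  exact: rdot_nonconstant_poly_op_ge0.
have pE := size1_polyC p1; rewrite pE poly_opC -[(_ *: idfun) x]/(_ *: x) rdotZl.
have [c0|c0] := leP 0 p`_0; first by rewrite (rdotxx hdot) mulr_ge0 ?sqr_ge0.
(* the spectrum is empty, so 'X - M - 1 is nonnegative on it for M >= |A| *)
have /bounded_opP[lA [M M0 hM]] := bA.
suff -> : x = 0 by rewrite rdot0l mulr0.
have : 0 <= <| poly_op ('X - (M + 1)%:P) A x, x |>.
  apply: rdot_nonconstant_poly_op_ge0 => // [|r /hp]; first by rewrite size_XsubC.
  by rewrite pE hornerC leNgt c0.
rewrite poly_opB poly_opC poly_opX// -[(_ - _) x]/(A x - _ *: x) rdotBl rdotZl.
have := rdot_le hdot (A x) x; rewrite (rdotxx hdot) ler_norml => /andP[_ h].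
have h2 := ler_wpM2r (rnorm_ge0 x) (hM x).
move=> h3; apply: rnorm_eq0; apply/eqP; rewrite -sqrf_eq0 eq_le sqr_ge0 andbT.
by move: h h2 h3; rewrite -mulrA -expr2; nra.
Qed.

End SelfAdjoint.

(** * Functional calculus *)

Section FunctionalCalculus.
Variables (R : realType) (H : completeNormedModType R[i]).
Variable dot : {dot H for Num.conj}.
Hypothesis hdot : forall x : H, `|x| ^+ 2 = dot x x.
Implicit Types (x y : H) (a b c e L M s : R) (f g : R -> R).
Local Notation "<| x , y |>" := (rdot dot x y) (at level 0).

Section SelfAdjointCalculus.
Variable A : H -> H.
Hypotheses (bA : bounded_op A) (sA : selfadjoint dot A).
Implicit Types B C : H -> H.

(** The polynomial e^2 - p^2 is nonnegative on the spectrum, and p(A) is self-adjoint, so its form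
    at A reads e^2 |x|^2 - |p(A) x|^2 >= 0. This estimate carries existence, uniqueness and
    multiplicativity of the calculus. *)
Lemma rnorm_poly_op_le (p : {poly R}) e : 0 <= e ->
  (forall r, spectrum A r%:C -> `|p.[r]| <= e) ->
  forall x, rnorm (poly_op p A x) <= e * rnorm x.
Proof.
move=> e0 hp x; have lA := bounded_linear bA.
rewrite -ler_sqr ?nnegrE ?mulr_ge0 ?rnorm_ge0//.
have : 0 <= <| poly_op ((e ^+ 2)%:P - p * p) A x, x |>.
  apply: (rdot_poly_op_ge0 hdot bA sA) => r /hp pr; rewrite !hornerE subr_ge0.
  by rewrite -expr2 -[leLHS]real_normK ?num_real// ler_sqr ?nnegrE.
rewrite poly_opB poly_opC poly_opM// -[(_ - _) x]/(_ *: x - poly_op p A (poly_op p A x)).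
rewrite rdotBl rdotZl (selfadjoint_rdot (selfadjoint_poly_op p sA)).
by rewrite !(rdotxx hdot) -exprMn subr_ge0.
Qed.

Lemma is_fcalcP f B : is_fcalc f A B <-> bounded_op B /\
  forall e, 0 < e -> exists2 p : {poly R},
    forall r, spectrum A r%:C -> `|p.[r] - f r| <= e &
    forall x, rnorm (poly_op p A x - B x) <= e * rnorm x.
Proof.
split=> -[bB hB]; split=> // e /hB.
  by move=> [p [hp hpB]]; exists p => // x; rewrite -lecR rmorphM/= -!rnormE.
by move=> [p hp hpB]; exists p; split=> // x; rewrite !rnormE -rmorphM lecR.
Qed.

Lemma is_fcalc_rdot_ge0 f B : is_fcalc f A B ->
  (forall r, spectrum A r%:C -> 0 <= f r) -> forall x, 0 <= <| B x, x |>.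
Proof.
move=> /is_fcalcP[_ hB] f0 x; apply/ler_addgt0Pl => e e0.
(* An approximant p within d of f becomes nonnegative on the spectrum after adding d. The shift and
   the error of p(A) each cost d |x|^2 <= e / 2. *)
pose d := e / (2 * (rnorm x ^+ 2 + 1)).
have x1 : 0 < rnorm x ^+ 2 + 1 by rewrite ltr_wpDl ?sqr_ge0.
have d0 : 0 < d by rewrite divr_gt0// mulr_gt0.
have [p hp hpB] := hB _ d0.
have : 0 <= <| poly_op (p + d%:P) A x, x |>.
  apply: (rdot_poly_op_ge0 hdot bA sA) => r sr; rewrite !hornerE.
  by have := hp _ sr; have := f0 _ sr; rewrite ler_norml => ? /andP[]; lra.
rewrite poly_opD poly_opC -[(_ + _) x]/(poly_op p A x + _ *: x) rdotDl rdotZl (rdotxx hdot).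
have := rdot_le hdot (poly_op p A x - B x) x; rewrite rdotBl ler_norml => /andP[_ h].
have h2 := ler_wpM2r (rnorm_ge0 x) (hpB x).
have h3 : d * rnorm x ^+ 2 <= e / 2.
  rewrite /d mulrAC ler_pdivrMr ?mulr_gt0//.
  have -> : e / 2 * (2 * (rnorm x ^+ 2 + 1)) = e * (rnorm x ^+ 2 + 1) by field.
  by rewrite ler_wpM2l ?(ltW e0)//; lra.
by move: h h2 h3; rewrite -mulrA -expr2; lra.
Qed.

Lemma is_fcalc_bounded f B : is_fcalc f A B -> bounded_op B. Proof. by case. Qed.

Lemma is_fcalc_selfadjoint f B : is_fcalc f A B -> selfadjoint dot B.
Proof.
move=> /is_fcalcP[bB hB]; apply: rdot_selfadjoint; first exact: bounded_linear.
move=> x y; apply/eqP; rewrite -subr_eq0 -normr_le0; apply/ler_addgt0Pl => e e0.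
rewrite addr0; pose N := 2 * (rnorm x * rnorm y) + 1.
have n0 : 0 <= rnorm x * rnorm y by rewrite mulr_ge0 ?rnorm_ge0.
have N0 : 0 < N by rewrite /N; lra.
have [p _ hp] := hB _ (divr_gt0 e0 N0).
have sp := selfadjoint_rdot (selfadjoint_poly_op p sA) x y.
have -> : <| B x, y |> - <| x, B y |> =
    <| x, poly_op p A y - B y |> - <| poly_op p A x - B x, y |>.
  by rewrite rdotBl rdotDr rdotNr sp; lra.
apply: le_trans (ler_normB _ _) _.
have h1 := le_trans (rdot_le hdot x (poly_op p A y - B y)) (ler_wpM2l (rnorm_ge0 x) (hp y)).
have h2 := le_trans (rdot_le hdot (poly_op p A x - B x) y) (ler_wpM2r (rnorm_ge0 y) (hp x)).
apply: le_trans (lerD h1 h2) _.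
have -> : rnorm x * (e / N * rnorm y) + e / N * rnorm x * rnorm y =
  e * ((N - 1) / N) by rewrite /N; field; rewrite gt_eqF.
by rewrite ler_piMr ?(ltW e0)// ler_pdivrMr// mul1r; lra.
Qed.

Lemma is_fcalc_poly (p : {poly R}) : is_fcalc (horner p) A (poly_op p A).
Proof.
apply/is_fcalcP; split; first exact: bounded_poly_op.
move=> e e0; exists p => [r _|x]; first by rewrite subrr normr0 ltW.
by rewrite subrr rnorm0 mulr_ge0 ?rnorm_ge0// ltW.
Qed.

Lemma eq_is_fcalc f g B : (forall r, spectrum A r%:C -> f r = g r) ->
  is_fcalc f A B -> is_fcalc g A B.
Proof.
move=> fg [bB hB]; split=> // e /hB[p [hp hpB]]; exists p; split=> // r sr.
by rewrite -fg// hp.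
Qed.

Lemma is_fcalc_id : is_fcalc id A A.
Proof.
have := is_fcalc_poly 'X; rewrite poly_opX; last exact: bounded_linear.
by apply: eq_is_fcalc => r _; rewrite hornerX.
Qed.

Lemma is_fcalc_cst a : is_fcalc (fun=> a) A (a%:C *: idfun).
Proof.
have := is_fcalc_poly a%:P; rewrite poly_opC.
by apply: eq_is_fcalc => r _; rewrite hornerC.
Qed.

Lemma is_fcalcD f g B C : is_fcalc f A B -> is_fcalc g A C ->
  is_fcalc (fun r => f r + g r) A (B + C).
Proof.
move=> /is_fcalcP[bB hB] /is_fcalcP[bC hC]; apply/is_fcalcP.
split=> [|e e0]; first exact: bounded_opD.
have e2 : 0 < e / 2 by rewrite divr_gt0.
have [p hp hpB] := hB _ e2; have [q hq hqC] := hC _ e2.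
exists (p + q) => [r sr|x].
  rewrite hornerD opprD addrACA (le_trans (ler_normD _ _))//.
  by have := hp _ sr; have := hq _ sr; lra.
rewrite poly_opD -[(poly_op p A + _) x]/(poly_op p A x + poly_op q A x).
rewrite -[(B + C) x]/(B x + C x) opprD addrACA (le_trans (rnormD _ _))//.
by have := hpB x; have := hqC x; lra.
Qed.

Lemma is_fcalcM f g B C M : (forall r, spectrum A r%:C -> `|f r| <= M) ->
  (forall r, spectrum A r%:C -> `|g r| <= M) ->
  is_fcalc f A B -> is_fcalc g A C -> is_fcalc (fun r => f r * g r) A (B \o C).
Proof.
move=> fM gM /is_fcalcP[bB hB] /is_fcalcP[bC hC]; apply/is_fcalcP.
split=> [|e e0]; first exact: bounded_op_comp.
have lA := bounded_linear bA.
have /bounded_opP[lC [N N0 hN]] := bC.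
(* M1 dominates 1, the bound M of f and g on the spectrum, and the norm bound N of C. With d <= 1 <=
   M1 both the scalar and the operator error are at most (M1 + d) d + d M1 <= 3 d M1 <= e. *)
pose M1 := `|M| + N + 1; have M10 : 0 < M1 by rewrite /M1; have := normr_ge0 M; lra.
have M1M : M <= M1 by have := ler_norm M; rewrite /M1; lra.
have M11 : 1 <= M1 by have := normr_ge0 M; rewrite /M1; lra.
have NM1 : N <= M1 by have := normr_ge0 M; rewrite /M1; lra.
pose d := Num.min 1 (e / (3 * M1)).
have d0 : 0 < d by rewrite /d lt_min ltr01 divr_gt0// mulr_gt0.
have d1 : d <= 1 by rewrite /d ge_min lexx.
have dM : 3 * (d * M1) <= e.
  have : d <= e / (3 * M1) by rewrite /d ge_min lexx orbT.
  by rewrite ler_pdivlMr ?mulr_gt0//; lra.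
have [p hp hpB] := hB _ d0; have [q hq hqC] := hC _ d0.
have pM r : spectrum A r%:C -> `|p.[r]| <= M1 + d.
  move=> sr; have -> : p.[r] = f r + (p.[r] - f r) by lra.
  apply: le_trans (ler_normD _ _) _; apply: lerD (hp _ sr).
  exact: le_trans (fM _ sr) _.
exists (p * q) => [r sr|x].
  have -> : (p * q).[r] - f r * g r = p.[r] * (q.[r] - g r) + (p.[r] - f r) * g r.
    by rewrite hornerM; lra.
  apply: le_trans (ler_normD _ _) _; rewrite !normrM.
  have h1 := ler_pM (normr_ge0 _) (normr_ge0 _) (pM _ sr) (hq _ sr).
  have h2 := ler_pM (normr_ge0 _) (normr_ge0 _) (hp _ sr) (le_trans (gM _ sr) M1M).
  apply: le_trans (lerD h1 h2) _; apply: le_trans dM; nra.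
rewrite poly_opM//=.
have lp := bounded_linear (bounded_poly_op p bA).
have -> : poly_op p A (poly_op q A x) - B (C x) =
  poly_op p A (poly_op q A x - C x) + (poly_op p A (C x) - B (C x)).
  by rewrite (linear_opB lp) subrKA.
apply: le_trans (rnormD _ _) _.
have Md : 0 <= M1 + d by lra.
have h1 := le_trans (rnorm_poly_op_le Md pM (poly_op q A x - C x)) (ler_wpM2l Md (hqC x)).
have h2 := le_trans (hpB (C x)) (ler_wpM2l (ltW d0) (hN x)).
apply: le_trans (lerD h1 h2) _; rewrite !mulrA -mulrDl ler_wpM2r ?rnorm_ge0//.
by apply: le_trans dM; nra.
Qed.

Lemma is_fcalcZ a f B : is_fcalc f A B -> is_fcalc (fun r => a * f r) A (a%:C *: B).
Proof.
move=> /is_fcalcP[bB hB]; apply/is_fcalcP; split=> [|e e0]; first exact: bounded_opZ.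
have a1 : 0 < `|a| + 1 by rewrite ltr_wpDl.
have [p hp hpB] := hB _ (divr_gt0 e0 a1).
have ae : `|a| * (e / (`|a| + 1)) <= e.
  by rewrite mulrCA ler_piMr ?(ltW e0)// ler_pdivrMr// mul1r; lra.
exists (a *: p) => [r sr|x].
  by rewrite hornerZ -mulrBr normrM; apply: le_trans (ler_wpM2l (normr_ge0 _) (hp _ sr)) ae.
rewrite poly_opZ -![(a%:C *: _) x]/(a%:C *: _) -scalerBr rnormZr.
apply: le_trans (ler_wpM2l (normr_ge0 _) (hpB x)) _.
by rewrite mulrA ler_wpM2r ?rnorm_ge0.
Qed.

Lemma is_fcalc_rdot_le f g B C : is_fcalc f A B -> is_fcalc g A C ->
  (forall r, spectrum A r%:C -> f r <= g r) ->
  forall x, <| B x, x |> <= <| C x, x |>.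
Proof.
move=> hB hC fg x.
have := is_fcalc_rdot_ge0 (is_fcalcD hC (is_fcalcZ (-1) hB)) _ x.
rewrite -[(C + _) x]/(C x + (-1)%:C *: B x) rdotDl rdotZl => h.
have : 0 <= <| C x, x |> + -1 * <| B x, x |>.
  by apply: h => r sr; have := fg _ sr; lra.
by lra.
Qed.

(** Two approximants of f within e differ by at most 2 e on the spectrum, hence as operators.
    Identities between functions on the spectrum thereby become identities between operators. *)
Lemma is_fcalc_unique f B C : is_fcalc f A B -> is_fcalc f A C -> B = C.
Proof.
move=> /is_fcalcP[_ hB] /is_fcalcP[_ hC]; apply/funext => x.
apply/eqP; rewrite -subr_eq0; apply/eqP.
apply: (@rnorm_le0 R H (4 * rnorm x)) => e e0.
have [p hp hpB] := hB _ e0; have [q hq hqC] := hC _ e0.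
have h : rnorm (poly_op (p - q) A x) <= 2 * e * rnorm x.
  apply: rnorm_poly_op_le => [|r sr]; first by rewrite mulr_ge0// ltW.
  rewrite hornerD hornerN; apply: le_trans (ler_distD (f r) _ _) _.
  by rewrite [X in _ + X]distrC mulr2n mulrDl mul1r lerD// ?hp// hq.
move: h; rewrite poly_opB -[(_ - _) x]/(poly_op p A x - poly_op q A x) => h.
apply: le_trans (rnorm_dist_triangle (poly_op p A x) _ _) _.
have := rnorm_dist_triangle (poly_op q A x) (poly_op p A x) (C x).
by have := hpB x; have := hqC x; rewrite (rnorm_distC (B x)); lra.
Qed.

(** Approximants p n within 1 / (n + 1) of f give operators that are Cauchy in norm by
    [rnorm_poly_op_le]. Their pointwise limit inherits the same error bound, which yields linearity
    and boundedness. *)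
Lemma is_fcalc_exists f : (forall e, 0 < e -> exists p : {poly R},
    forall r, spectrum A r%:C -> `|p.[r] - f r| <= e) ->
  exists B, is_fcalc f A B.
Proof.
move=> hf; have n0 (n : nat) : 0 < (n.+1%:R : R)^-1 by rewrite invr_gt0 ltr0n.
have [p hp] := boolp.choice (fun n => hf _ (n0 n)).
have pd m n x : rnorm (poly_op (p m) A x - poly_op (p n) A x) <=
    (m.+1%:R^-1 + n.+1%:R^-1) * rnorm x.
  rewrite -[_ - _]/((poly_op (p m) A - poly_op (p n) A) x) -poly_opB.
  apply: rnorm_poly_op_le => [|r sr]; first by rewrite addr_ge0// ltW.
  rewrite hornerD hornerN; apply: le_trans (ler_distD (f r) _ _) _.
  by rewrite [X in _ + X]distrC lerD// hp.
have small c e : 0 < e -> 0 <= c -> exists N, forall n, (N <= n)%N -> n.+1%:R^-1 * c <= e.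
  move=> e0 c0; exists (Num.bound (c / e)) => n Nn.
  rewrite ler_pdivrMl ?ltr0n// -ler_pdivrMr//.
  apply: le_trans (ltW (archi_boundP (divr_ge0 c0 (ltW e0)))) _.
  by rewrite ler_nat (leq_trans Nn).
have cv x : exists l, forall e, 0 < e ->
    exists N, forall n, (N <= n)%N -> rnorm (poly_op (p n) A x - l) <= e.
  apply: complete_rnorm => e e0.
  have [N hN] := small (rnorm x) (e / 2) (divr_gt0 e0 (ltr0Sn _ _)) (rnorm_ge0 x).
  exists N => n Nn; apply: le_trans (pd _ _ _) _.
  by rewrite mulrDl [e]splitr; apply: lerD; apply: hN.
have [B hB] := boolp.choice cv.
have pB n x : rnorm (poly_op (p n) A x - B x) <= n.+1%:R^-1 * rnorm x.
  apply/ler_addgt0Pr => e e0; have e2 : 0 < e / 2 by rewrite divr_gt0.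
  have [N hN] := hB x _ e2; have [N' hN'] := small _ _ e2 (rnorm_ge0 x).
  pose m := maxn N N'.
  apply: le_trans (rnorm_dist_triangle (poly_op (p m) A x) _ _) _.
  have h1 := pd n m x; rewrite mulrDl in h1.
  apply: le_trans (lerD h1 (hN m (leq_maxl _ _))) _.
  by rewrite -addrA lerD2l [leRHS]splitr lerD2r; exact: hN' (leq_maxr _ _).
have lp n := bounded_linear (bounded_poly_op (p n) bA).
have lB : linear B.
  move=> w x y; apply/eqP; rewrite -subr_eq0; apply/eqP.
  pose c := rnorm (w *: x + y) + (complex.Re `|w| * rnorm x + rnorm y).
  apply: (@rnorm_le0 R H 1) => e e0; rewrite mul1r.
  have [|N /(_ N (leqnn N)) hN] := small c e e0.
    by rewrite !addr_ge0 ?mulr_ge0 ?rnorm_ge0 ?Re_norm_ge0.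
  apply: le_trans hN; rewrite /c mulrDr.
  apply: le_trans (rnorm_dist_triangle (poly_op (p N) A (w *: x + y)) _ _) _.
  rewrite lerD//; first by rewrite rnorm_distC.
  rewrite lp opprD addrACA -scalerBr mulrDr (le_trans (rnormD _ _))// lerD//.
  by rewrite rnormZ mulrCA ler_wpM2l// Re_norm_ge0.
exists B; apply/is_fcalcP; split.
  apply/bounded_opP; split=> //.
  have /bounded_opP[_ [M M0 hM]] := bounded_poly_op (p 0) bA.
  exists (M + 1) => [|x]; first by rewrite addr_ge0.
  have := pB 0 x; rewrite invr1 => h; have := hM x.
  have := rnorm_dist_triangle (poly_op (p 0) A x) (B x) 0.
  by rewrite !subr0 (rnorm_distC (B x)); lra.
move=> e e0; have [N /(_ N (leqnn N))] := small 1 e e0 ler01.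
rewrite mulr1 => hN; exists (p N) => [r sr|x]; first exact: le_trans (hp _ _ sr) hN.
by apply: le_trans (pB _ _) _; rewrite ler_wpM2r ?rnorm_ge0.
Qed.

Lemma lipschitz_is_fcalc f a b L :
  (forall r, spectrum A r%:C -> a <= r <= b) -> lipschitz_itv a b L f ->
  is_fcalc f A (fcalc f A).
Proof.
move=> ab fL; apply: xgetPex; apply: is_fcalc_exists => e e0.
by have [p hp] := lipschitz_poly_approx fL e0; exists p => r /ab; apply: hp.
Qed.

End SelfAdjointCalculus.

(** * Logarithm and powers of a positive invertible operator *)

Section PositiveCalculus.
Variable A : H -> H.
Hypothesis pA : pos_op dot A.

Lemma pos_op_bounded : bounded_op A. Proof. by case: pA. Qed.
Lemma pos_op_psd : psd dot A. Proof. by case: pA. Qed.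
Lemma pos_op_selfadjoint : selfadjoint dot A. Proof. by case: pos_op_psd. Qed.
Lemma pos_op_opinv : is_opinv A (opinv A).
Proof. by apply: xgetPex; case: pA. Qed.

(** Here a is a coercivity constant and b a norm bound: for r < a the operator A - r is coercive,
    for r > b its opposite is, and either way r is not in the spectrum. *)
Lemma pos_op_spectrum : exists a b, 0 < a /\
  forall r, spectrum A r%:C -> a <= r <= b.
Proof.
have bA := pos_op_bounded.
have [a a0 ha] := psd_invertible_coercive hdot bA pos_op_psd pos_op_opinv.
have /bounded_opP[lA [b b0 hb]] := bA; exists a, b; split=> // r sr.
have bAr : bounded_op (A - r%:C *: idfun).
  by apply: bounded_opB => //; apply: bounded_opZ; exact: bounded_op_id.
have ArE x : <| (A - r%:C *: idfun) x, x |> = <| A x, x |> - r * rnorm x ^+ 2.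
  by rewrite -[(_ - _) x]/(A x - _ *: x) rdotBl rdotZl (rdotxx hdot).
rewrite !leNgt -negb_or; apply/negP => /orP[ra|br]; apply: sr.
  apply: (@coercive_invertible _ _ dot hdot _ (a - r)) => //; first by rewrite subr_gt0.
  by move=> x; rewrite ArE mulrBl; have := ha x; lra.
have [|||B iB] := @coercive_invertible _ _ dot hdot (- (A - r%:C *: idfun)) (r - b).
- exact: bounded_opN.
- by rewrite subr_gt0.
- move=> x; rewrite -[(- _) x]/(- ((A - r%:C *: idfun) x)) rdotNl ArE mulrBl.
  have := rdot_le hdot (A x) x; rewrite ler_norml => /andP[_ h].
  by have := ler_wpM2r (rnorm_ge0 x) (hb x); rewrite -mulrA -expr2; lra.
have n1 : (-1 : R[i]) != 0 by rewrite oppr_eq0 oner_eq0.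
have := is_opinvZ n1 iB (bounded_linear (bounded_opN bAr)).
by rewrite scaleN1r opprK => ?; eexists; eassumption.
Qed.

Lemma is_fcalc_oplog : is_fcalc (@ln R) A (oplog A).
Proof.
have [a [b [a0 ab]]] := pos_op_spectrum.
exact: (lipschitz_is_fcalc pos_op_bounded pos_op_selfadjoint ab (lipschitz_ln a0)).
Qed.

Lemma is_fcalc_oppow s : is_fcalc (fun r => r `^ s) A (oppow A s).
Proof.
have [a [b [a0 ab]]] := pos_op_spectrum; have [L hL] := lipschitz_powR b s a0.
exact: (lipschitz_is_fcalc pos_op_bounded pos_op_selfadjoint ab hL).
Qed.

Lemma pos_op_spectrum_gt0 r : spectrum A r%:C -> 0 < r.
Proof. by have [a [b [a0 ab]]] := pos_op_spectrum => /ab/andP[ar _]; apply: lt_le_trans ar. Qed.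

Lemma powR_spectrum_bounded s : exists M, forall r, spectrum A r%:C -> `|r `^ s| <= M.
Proof.
have [a [b [a0 ab]]] := pos_op_spectrum; have [L hL] := lipschitz_powR b s a0.
exists (`|a `^ s| + `|L| * (b - a)) => r /ab arb; have /andP[ar rb] := arb.
have -> : r `^ s = a `^ s + (r `^ s - a `^ s) by lra.
apply: le_trans (ler_normD _ _) _; rewrite lerD2l.
have aab : a <= a <= b by rewrite lexx (le_trans ar rb).
apply: le_trans (hL _ _ arb aab) _.
rewrite ger0_norm ?subr_ge0//; apply: (@le_trans _ _ (`|L| * (r - a))).
  by rewrite ler_wpM2r ?subr_ge0// ler_norm.
by rewrite ler_wpM2l// lerB.
Qed.

Lemma is_fcalc_oppowD s t : is_fcalc (fun r => r `^ (s + t)) A (oppow A s \o oppow A t).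
Proof.
have [M hM] := powR_spectrum_bounded s; have [N hN] := powR_spectrum_bounded t.
apply: eq_is_fcalc (is_fcalcM pos_op_bounded pos_op_selfadjoint (M := Num.max M N)
  _ _ (is_fcalc_oppow s) (is_fcalc_oppow t)) => r sr.
- by rewrite powRD//; apply/implyP => _; rewrite gt_eqF// pos_op_spectrum_gt0.
- by rewrite le_max hM.
- by rewrite le_max hN ?orbT.
Qed.

Lemma oppowVK s x : oppow A s (oppow A (- s) x) = x.
Proof.
have h := is_fcalc_oppowD s (- s).
have h1 := is_fcalc_cst pos_op_bounded 1.
have E : oppow A s \o oppow A (- s) = (1 : R)%:C *: idfun.
  apply: is_fcalc_unique h _; [exact: pos_op_bounded|exact: pos_op_selfadjoint|].
  by apply: eq_is_fcalc h1 => r sr; rewrite subrr powRr0.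
by rewrite -[LHS]/((oppow A s \o oppow A (- s)) x) E -[LHS]/(1 *: x) scale1r.
Qed.

Lemma oppow12K x : oppow A 2^-1 (oppow A 2^-1 x) = A x.
Proof.
have E : oppow A 2^-1 \o oppow A 2^-1 = A.
  apply: is_fcalc_unique (is_fcalc_oppowD _ _) _;
    [exact: pos_op_bounded|exact: pos_op_selfadjoint|].
  apply: eq_is_fcalc (is_fcalc_id pos_op_bounded) => r /pos_op_spectrum_gt0 r0.
  have -> : 2^-1 + 2^-1 = 1 :> R by field.
  by rewrite powRr1// ltW.
by rewrite -[LHS]/((oppow A 2^-1 \o oppow A 2^-1) x) E.
Qed.

Lemma oppow_bounded s : bounded_op (oppow A s).
Proof. exact: is_fcalc_bounded (is_fcalc_oppow s). Qed.

Lemma oppow_rdot s x y : <| oppow A s x, y |> = <| x, oppow A s y |>.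
Proof.
exact: selfadjoint_rdot (is_fcalc_selfadjoint pos_op_selfadjoint (is_fcalc_oppow s)) x y.
Qed.

Lemma oppow_is_opinv s : is_opinv (oppow A s) (oppow A (- s)).
Proof.
apply: is_opinvP => [|x|x]; first exact: oppow_bounded.
  exact: oppowVK.
by rewrite -{2}[s]opprK oppowVK.
Qed.

(** The algebraic inverse is identified with the power -1: A^1 = A by uniqueness, and A^1 and A^(-1)
    are mutually inverse. *)
Lemma is_fcalc_opinv : is_fcalc (fun r => r^-1) A (opinv A).
Proof.
have h := is_fcalc_oppow (-1).
have E1 : oppow A 1 = A.
  apply: is_fcalc_unique (is_fcalc_oppow 1) _; [exact: pos_op_bounded|exact: pos_op_selfadjoint|].
  apply: eq_is_fcalc (is_fcalc_id pos_op_bounded) => r /pos_op_spectrum_gt0 r0.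
  by rewrite powRr1// ltW.
have := oppow_is_opinv 1; rewrite E1 => /opinvE ->.
by apply: eq_is_fcalc h => r /pos_op_spectrum_gt0 r0; rewrite powR_inv1// ltW.
Qed.

Lemma rdot_oppow_le p x : 0 <= p <= 1 ->
  <| oppow A p x, x |> <= (1 - p) * <| x, x |> + p * <| A x, x |>.
Proof.
move=> p01.
have h := is_fcalcD (is_fcalc_cst pos_op_bounded (1 - p))
  (is_fcalcZ p (is_fcalc_id pos_op_bounded)).
have := is_fcalc_rdot_le pos_op_bounded pos_op_selfadjoint (is_fcalc_oppow p) h.
rewrite -rdotZl -rdotZl -rdotDl; apply => r /pos_op_spectrum_gt0 r0.
exact: powR_le_lin.
Qed.

Lemma rdot_oppow_ge q x : 0 <= q ->
  (1 + q) * <| x, x |> - q * <| opinv A x, x |> <= <| oppow A q x, x |>.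
Proof.
move=> q0.
have h := is_fcalcD (is_fcalc_cst pos_op_bounded (1 + q)) (is_fcalcZ (- q) is_fcalc_opinv).
have := is_fcalc_rdot_le pos_op_bounded pos_op_selfadjoint h (is_fcalc_oppow q).
rewrite -mulNr -rdotZl -rdotZl -rdotDl; apply => r /pos_op_spectrum_gt0 r0.
by rewrite mulNr; exact: powR_ge_inv.
Qed.

Lemma rdot_oplog_ge x : <| x, x |> - <| opinv A x, x |> <= <| oplog A x, x |>.
Proof.
have h := is_fcalcD (is_fcalc_cst pos_op_bounded 1) (is_fcalcZ (-1) is_fcalc_opinv).
have := is_fcalc_rdot_le pos_op_bounded pos_op_selfadjoint h is_fcalc_oplog.
have -> : <| x, x |> - <| opinv A x, x |> = 1 * <| x, x |> + -1 * <| opinv A x, x |>.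
  by rewrite mul1r mulN1r.
rewrite -rdotZl -rdotZl -rdotDl; apply => r /pos_op_spectrum_gt0 r0.
by rewrite mulN1r; exact: ln_ge_1BV.
Qed.

End PositiveCalculus.
End FunctionalCalculus.

(** * Power means and ordered means *)

Section ScalarMeans.
Variable R : realType.
Implicit Types a b p t : R.

Lemma scalar_power_mean2E p t a b :
  scalar_power_mean p (tnth [tuple 1 - t; t]) (tnth [tuple a; b]) =
  if p == 0 then a `^ (1 - t) * b `^ t
  else ((1 - t) * a `^ p + t * b `^ p) `^ p^-1.
Proof.
rewrite /scalar_power_mean; case: ifP => _.
  by rewrite !big_ord_recl big_ord0 mulr1 !(tnth_nth 0).
by rewrite !big_ord_recl big_ord0 addr0 !(tnth_nth 0).
Qed.

(** With h the inverse of the harmonic mean, the weighted mean of 1 / (a h) and 1 / (b h) is 1. The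
    tangent bounds at these points, or at a h and b h, thus add up to a comparison with 1;
    homogeneity removes h. *)
Lemma harmonic_le_power_mean p t a b : 0 < a -> 0 < b -> 0 <= t <= 1 -> -1 <= p <= 1 ->
  ((1 - t) / a + t / b)^-1 <=
  scalar_power_mean p (tnth [tuple 1 - t; t]) (tnth [tuple a; b]).
Proof.
move=> a0 b0 /andP[t0 t1] /andP[pN1 p1]; rewrite scalar_power_mean2E.
set h := _ / a + _ / b.
have u0 : 0 <= 1 - t by rewrite subr_ge0.
have h0 : 0 < h.
  have [tE|tn0] := eqVneq t 0; first by rewrite /h tE subr0 mul0r addr0 mul1r invr_gt0.
  by rewrite /h ltr_wpDl ?divr_ge0 ?divr_gt0 ?(ltW a0)// lt_neqAle eq_sym tn0.
have ah : 0 < a * h by exact: mulr_gt0.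
have bh : 0 < b * h by exact: mulr_gt0.
have hE : (1 - t) * (a * h)^-1 + t * (b * h)^-1 = 1.
  by rewrite !invfM !mulrA -mulrDl -/h divff// gt_eqF.
have [pE|pn0] := eqVneq p 0.
  rewrite -[leLHS]lnK ?posrE ?invr_gt0// !powR_expR// -expRD ler_expR lnV ?posrE//.
  have := ler_wpM2l u0 (ln_ge_1BV ah); have := ler_wpM2l t0 (ln_ge_1BV bh).
  rewrite !lnM ?posrE//; lra.
have powM x q : 0 < x -> (x * h) `^ q = x `^ q * h `^ q by move=> x0; rewrite powRM ?ltW.
have S0 : 0 <= (1 - t) * a `^ p + t * b `^ p by rewrite addr_ge0 ?mulr_ge0 ?powR_ge0.
have [p0|p0] := ltP 0 p.
  have key : 1 <= ((1 - t) * a `^ p + t * b `^ p) * h `^ p.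
    have := ler_wpM2l u0 (powR_ge_inv ah (ltW p0)).
    have := ler_wpM2l t0 (powR_ge_inv bh (ltW p0)).
    rewrite !powM// => k1 k2; have k3 := congr1 ( *%R p) hE; rewrite mulrDl -!mulrA; lra.
  have -> : h^-1 = (h^-1 `^ p) `^ p^-1 by rewrite -powRrM divff// powRr1// invr_ge0 ltW.
  rewrite ge0_ler_powR ?nnegrE ?powR_ge0 ?invr_ge0 ?(ltW p0)//.
  rewrite -(powR_inv1 (ltW h0)) -powRrM mulN1r powRN -[leLHS]mul1r.
  by rewrite ler_pdivrMr ?powR_gt0.
pose q := - p; have q0 : 0 < q by rewrite oppr_gt0 lt_neqAle pn0.
have q1 : 0 <= q <= 1 by rewrite /q; lra.
have key : ((1 - t) * a `^ p + t * b `^ p) * h `^ p <= 1.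
  have := ler_wpM2l u0 (powR_le_lin (_ : 0 < (a * h)^-1) q1).
  have := ler_wpM2l t0 (powR_le_lin (_ : 0 < (b * h)^-1) q1).
  rewrite !invr_gt0 => /(_ bh) k1 /(_ ah) k2.
  have inv x : 0 < x -> x^-1 `^ q = x `^ p.
    by move=> x0; rewrite -(powR_inv1 (ltW x0)) -powRrM mulN1r /q opprK.
  move: k1 k2; rewrite !inv// !powM// => k1 k2.
  have k3 := congr1 ( *%R q) hE; rewrite mulrDl -!mulrA; lra.
(* The negative outer exponent is split into a positive power followed by an inversion, which
   reverses the inequality [key]. *)
have -> : p^-1 = q^-1 * (-1) by rewrite mulrN1 /q invrN opprK.
rewrite powRrM powR_inv1 ?powR_ge0// lef_pV2 ?posrE ?powR_gt0//; last first.
  have [t00|tn0] := eqVneq t 0; first by rewrite t00 subr0 mul1r mul0r addr0 powR_gt0.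
  by rewrite ltr_wpDl ?mulr_ge0 ?powR_ge0// mulr_gt0 ?powR_gt0// lt_neqAle eq_sym tn0.
have -> : h = (h `^ q) `^ q^-1 by rewrite -powRrM divff ?gt_eqF// powRr1// ltW.
rewrite ge0_ler_powR ?nnegrE ?powR_ge0 ?invr_ge0 ?(ltW q0)//.
by rewrite /q powRN -[leRHS]mul1r ler_pdivlMr ?powR_gt0.
Qed.

(* Kantorovich: with u, v the arithmetic and inverse harmonic means,
   u + a b v = a + b, so u v <= (a + b)^2 / (4 a b) by AM-GM. *)
Lemma kantorovich t a b : 0 < a -> 0 < b -> 0 <= t <= 1 ->
  ((1 - t) * a + t * b) * ((1 - t) / a + t / b) <= (a + b) ^+ 2 / (4 * a * b).
Proof.
move=> a0 b0 /andP[t0 t1]; rewrite ler_pdivlMr ?mulr_gt0//.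
have -> : ((1 - t) * a + t * b) * ((1 - t) / a + t / b) * (4 * a * b) =
  4 * ((1 - t) * a + t * b) * ((1 - t) * b + t * a).
  by field; rewrite !gt_eqF.
have := sqr_ge0 (((1 - t) * a + t * b) - ((1 - t) * b + t * a)); lra.
Qed.

(** K bounds the ratio of the arithmetic to the harmonic mean, so dividing a and b by K pushes their
    arithmetic mean below the harmonic mean. *)
Lemma arithmetic_le_power_mean p t a b : 0 < a -> 0 < b -> 0 <= t <= 1 -> -1 <= p <= 1 ->
  let K := (a + b) ^+ 2 / (4 * a * b) in
  is_true ((1 - t) * (a / K) + t * (b / K) <=
  scalar_power_mean p (tnth [tuple 1 - t; t]) (tnth [tuple a; b])).
Proof.
move=> a0 b0 t01 p1 K; apply: le_trans (harmonic_le_power_mean a0 b0 t01 p1).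
have K0 : 0 < K by rewrite divr_gt0 ?exprn_gt0 ?addr_gt0 ?mulr_gt0.
have h0 : 0 < (1 - t) / a + t / b.
  case/andP: t01; rewrite le_eqVlt => /predU1P[<-|t0] t1.
    by rewrite subr0 mul0r addr0 mul1r invr_gt0.
  by rewrite ltr_wpDl ?divr_ge0 ?divr_gt0 ?subr_ge0// ltW.
rewrite !mulrA -mulrDl ler_pdivrMr// ler_pdivlMl// mulrC.
exact: kantorovich.
Qed.

End ScalarMeans.

Section OperatorMeans.
Variables (R : realType) (H : completeNormedModType R[i]).
Variable dot : {dot H for Num.conj}.
Hypothesis hdot : forall x : H, `|x| ^+ 2 = dot x x.
Implicit Types (x y : H) (A B M N X Y : H -> H) (a b c d p q s t : R).
Local Notation "<| x , y |>" := (rdot dot x y) (at level 0).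

Lemma loewner_rdot_le A B : loewner dot A B ->
  forall x, <| A x, x |> <= <| B x, x |>.
Proof. by move=> AB; have [sBA _] := AB; apply/(loewnerP sBA). Qed.

(** Together with [pos_op_coercive] this replaces invertibility by coercivity, which, unlike an
    inverse, passes directly to sums and to larger operators. *)
Lemma coercive_pos_op A c : bounded_op A -> selfadjoint dot A -> 0 < c ->
  (forall x, c * rnorm x ^+ 2 <= <| A x, x |>) -> pos_op dot A.
Proof.
move=> bA sA c0 hc; split=> //; last exact: coercive_invertible hc.
by apply/(psdP sA) => x; apply: le_trans (hc x); rewrite mulr_ge0 ?sqr_ge0// ltW.
Qed.

Lemma pos_op_coercive A : pos_op dot A ->
  exists2 c, 0 < c & forall x, c * rnorm x ^+ 2 <= <| A x, x |>.
Proof.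
move=> pA; apply: (psd_invertible_coercive hdot _ _ (pos_op_opinv pA)).
  exact: pos_op_bounded pA.
exact: pos_op_psd.
Qed.

Lemma pos_opD A B : pos_op dot A -> pos_op dot B -> pos_op dot (A + B).
Proof.
move=> pA pB; have [c c0 hc] := pos_op_coercive pA.
apply: (coercive_pos_op _ _ c0) => [||x].
- exact: bounded_opD (pos_op_bounded pA) (pos_op_bounded pB).
- exact: selfadjointD (pos_op_selfadjoint pA) (pos_op_selfadjoint pB).
- rewrite -[(A + B) x]/(A x + B x) rdotDl ler_wpDr//.
  exact: psd_rdot (pos_op_psd pB).
Qed.

Lemma pos_opZ a A : 0 < a -> pos_op dot A -> pos_op dot (a%:C *: A).
Proof.
move=> a0 pA; have [c c0 hc] := pos_op_coercive pA.
apply: (coercive_pos_op _ _ (mulr_gt0 a0 c0)) => [||x].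
- exact: bounded_opZ (pos_op_bounded pA).
- exact: selfadjointZ (pos_op_selfadjoint pA).
- by rewrite -[(a%:C *: A) x]/(a%:C *: A x) rdotZl -mulrA ler_wpM2l// ltW.
Qed.

Lemma pos_op_id : pos_op dot idfun.
Proof.
apply: (coercive_pos_op _ _ ltr01) => [||x]; first exact: bounded_op_id.
  exact: selfadjoint_id.
by rewrite mul1r (rdotxx hdot).
Qed.

Lemma pos_op_inv A : pos_op dot A -> pos_op dot (opinv A).
Proof.
move=> pA; have iA := pos_op_opinv pA; have bA := pos_op_bounded pA.
have sA' := selfadjoint_opinv (pos_op_selfadjoint pA) iA.
split; [by case: iA| |by exists A; exact: is_opinv_sym].
apply/(psdP sA') => x; rewrite -{2}(is_opinvK iA x) rdotC.
exact: psd_rdot (pos_op_psd pA).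
Qed.

Lemma opinvK A : pos_op dot A -> opinv (opinv A) = A.
Proof.
by move=> pA; apply/opinvE/is_opinv_sym; [exact: pos_op_bounded pA|exact: pos_op_opinv pA].
Qed.

Lemma congr_is_opinv s M X : pos_op dot M -> pos_op dot X ->
  is_opinv (oppow M s \o X \o oppow M s)
           (oppow M (- s) \o opinv X \o oppow M (- s)).
Proof.
move=> pM pX; have iM := oppow_is_opinv hdot pM s.
exact: is_opinv_comp (is_opinv_comp iM (pos_op_opinv pX)) iM.
Qed.

Lemma congr_pos_op s M X : pos_op dot M -> pos_op dot X ->
  pos_op dot (oppow M s \o X \o oppow M s).
Proof.
move=> pM pX; have bM := oppow_bounded hdot pM s.
have bT : bounded_op (oppow M s \o X \o oppow M s).
  by do 2?[apply: bounded_op_comp => //]; exact: pos_op_bounded pX.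
have sT : selfadjoint dot (oppow M s \o X \o oppow M s).
  apply: rdot_selfadjoint; first exact: bounded_linear.
  move=> x y /=; rewrite (oppow_rdot hdot pM) -[RHS](oppow_rdot hdot pM).
  exact: selfadjoint_rdot (pos_op_selfadjoint pX) _ _.
split=> //; last by eexists; exact: congr_is_opinv.
by apply/(psdP sT) => x /=; rewrite (oppow_rdot hdot pM) psd_rdot//; case: pX.
Qed.

Lemma rdot_congr s M X x : pos_op dot M ->
  <| (oppow M s \o X \o oppow M s) x, x |> = <| X (oppow M s x), oppow M s x |>.
Proof. by move=> pM /=; rewrite (oppow_rdot hdot pM). Qed.

Lemma oppowNK M s x : pos_op dot M -> oppow M (- s) (oppow M s x) = x.
Proof. by move=> pM; rewrite -{2}[s]opprK (oppowVK hdot pM). Qed.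

Lemma rdot_oppow12 M x : pos_op dot M ->
  <| oppow M 2^-1 x, oppow M 2^-1 x |> = <| M x, x |>.
Proof. by move=> pM; rewrite -(oppow_rdot hdot pM) (oppow12K hdot pM). Qed.

(** The bound on T^p for T = M^(-1/2) X M^(-1/2) is tested at M^(1/2) x: the identity contributes <M
    x, x>, and in T the outer roots cancel, leaving <X x, x>. *)
Lemma rdot_geom_le p M X x : pos_op dot M -> pos_op dot X -> 0 <= p <= 1 ->
  <| geom p M X x, x |> <= (1 - p) * <| M x, x |> + p * <| X x, x |>.
Proof.
move=> pM pX p01; rewrite rdot_congr//.
apply: le_trans (rdot_oppow_le hdot (congr_pos_op _ pM pX) _ p01) _.
by rewrite rdot_oppow12// rdot_congr// oppowNK.
Qed.

(** Now the bound involves T^(-1) = M^(1/2) X^(-1) M^(1/2); at M^(1/2) x the roots combine instead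
    of cancelling, so X^(-1) is tested at M x. *)
Lemma rdot_geom_ge q M X x : pos_op dot M -> pos_op dot X -> 0 <= q ->
  (1 + q) * <| M x, x |> - q * <| opinv X (M x), M x |> <= <| geom q M X x, x |>.
Proof.
move=> pM pX q0; rewrite rdot_congr//.
apply: le_trans (rdot_oppow_ge hdot (congr_pos_op _ pM pX) _ q0).
rewrite rdot_oppow12// (opinvE (congr_is_opinv _ pM pX)) rdot_congr// opprK.
by rewrite (oppow12K hdot pM).
Qed.

Lemma rdot_karcher_ge M X x : pos_op dot M -> pos_op dot X ->
  <| M x, x |> - <| X x, x |> <=
  <| oplog (oppow M 2^-1 \o opinv X \o oppow M 2^-1) (oppow M 2^-1 x), oppow M 2^-1 x |>.
Proof.
move=> pM pX; have pX' := pos_op_inv pX.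
apply: le_trans (rdot_oplog_ge hdot (congr_pos_op _ pM pX') _).
rewrite rdot_oppow12// (opinvE (congr_is_opinv _ pM pX')) rdot_congr// opinvK//.
by rewrite oppowNK.
Qed.

Lemma rdot_suml (I : Type) (r : seq I) (F : I -> H) y :
  <| \sum_(i <- r) F i, y |> = \sum_(i <- r) <| F i, y |>.
Proof.
by elim/big_rec2: _ => [|i u v _ <-]; rewrite ?rdot0l ?rdotDl.
Qed.

Lemma rdot_comb k (l : 'I_k -> R) (F : 'I_k -> H -> H) x y :
  <| (\sum_(i < k) (l i)%:C *: F i) x, y |> = \sum_(i < k) l i * <| F i x, y |>.
Proof.
by rewrite fct_sumE rdot_suml; apply: eq_bigr => i _; rewrite -rdotZl.
Qed.

(** * Operator power means lie below the arithmetic mean *)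

Section PowerMean.
Variables (k : nat) (l : 'I_k -> R) (Xs : 'I_k -> H -> H).
Hypotheses (hl : prob_vector l) (pX : forall i, pos_op dot (Xs i)).

Let l0 i : 0 <= l i. Proof. by rewrite ltW//; case: hl. Qed.
Let l1 : \sum_(i < k) l i = 1. Proof. by case: hl. Qed.

Lemma arithmetic_ge0 x : 0 <= \sum_(i < k) l i * <| Xs i x, x |>.
Proof.
by apply: sumr_ge0 => i _; rewrite mulr_ge0// psd_rdot//; exact: pos_op_psd.
Qed.

(** Bounding each term of the fixed-point equation leaves <M x, x> <= (1 - p) <M x, x> + p S, with S
    the arithmetic mean of the forms; it remains to cancel and divide by p. *)
Lemma is_power_mean_le p M x : 0 < p <= 1 -> is_power_mean dot p l Xs M ->
  <| M x, x |> <= \sum_(i < k) l i * <| Xs i x, x |>.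
Proof.
move=> /andP[p0 p1] [pM ME].
have : <| M x, x |> <= \sum_(i < k) l i * ((1 - p) * <| M x, x |> + p * <| Xs i x, x |>).
  rewrite {1}ME rdot_comb; apply: ler_sum => i _; rewrite ler_wpM2l// rdot_geom_le//.
  by rewrite ltW.
under eq_bigr do rewrite mulrDr mulrCA [_ * (p * _)]mulrCA.
rewrite big_split/= -!mulr_sumr -mulr_suml l1 mul1r => h; rewrite -(ler_pM2l p0); lra.
Qed.

(** The equation of N is tested at y = N^(-1) x, because [rdot_geom_ge] evaluates the inverses of
    the data, which are the Xs i, at N y = x. *)
Lemma is_power_mean_inv_le q N x : 0 < q <= 1 ->
  is_power_mean dot q l (fun i => opinv (Xs i)) N ->
  <| opinv N x, x |> <= \sum_(i < k) l i * <| Xs i x, x |>.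
Proof.
move=> /andP[q0 q1] [pN NE]; have iN := pos_op_opinv pN.
pose y := opinv N x; have Ny : N y = x by rewrite /y (is_opinvK iN).
have : \sum_(i < k) l i * ((1 + q) * <| N y, y |> - q * <| Xs i x, x |>) <= <| N y, y |>.
  rewrite {2}NE rdot_comb; apply: ler_sum => i _; rewrite ler_wpM2l//.
  have := rdot_geom_ge y pN (pos_op_inv (pX i)) (ltW q0).
  by rewrite opinvK// Ny.
under eq_bigr do rewrite mulrBr mulrCA [_ * (q * _)]mulrCA.
rewrite sumrB -!mulr_sumr -mulr_suml l1 mul1r Ny (rdotC _ x) => h; rewrite -(ler_pM2l q0); lra.
Qed.

Lemma is_karcher_mean_le M x : is_karcher_mean dot l Xs M ->
  <| M x, x |> <= \sum_(i < k) l i * <| Xs i x, x |>.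
Proof.
move=> [pM ME]; pose y := oppow M 2^-1 x.
have : \sum_(i < k) l i * (<| M x, x |> - <| Xs i x, x |>) <=
    <| (\sum_(i < k) (l i)%:C *:
      oplog (oppow M 2^-1 \o opinv (Xs i) \o oppow M 2^-1)) y, y |>.
  by rewrite rdot_comb; apply: ler_sum => i _; rewrite ler_wpM2l// rdot_karcher_ge.
rewrite ME -[(0 : H -> H) y]/(0 : H) rdot0l.
under eq_bigr do rewrite mulrBr.
by rewrite sumrB -mulr_suml l1 mul1r subr_le0.
Qed.

(* The junk value 0 of xget satisfies the bound, so the existence of the power
   mean is irrelevant here. *)
Lemma power_mean_le p : -1 <= p <= 1 -> selfadjoint dot (power_mean dot p l Xs) /\
  forall x, <| power_mean dot p l Xs x, x |> <= \sum_(i < k) l i * <| Xs i x, x |>.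
Proof.
move=> /andP[pN1 p1].
have le0 x : <| (0 : H -> H) x, x |> <= \sum_(i < k) l i * <| Xs i x, x |>.
  by rewrite -[(0 : H -> H) x]/(0 : H) rdot0l arithmetic_ge0.
have s0 : selfadjoint dot 0 by exact: selfadjoint0.
rewrite /power_mean; case: ltP => [p0|p0].
  rewrite /power_mean_pos; case: xgetP => [M _ hM|_]; last by [].
  split=> [|x]; first by case: hM => pM _; exact: pos_op_selfadjoint.
  by apply: is_power_mean_le hM; rewrite p0.
case: ltP => [p0'|p0'].
  rewrite /power_mean_pos; case: xgetP => [N _ hN|_].
    split=> [|x]; first by case: hN => pN _; exact: pos_op_selfadjoint (pos_op_inv pN).
    by apply: is_power_mean_inv_le hN; rewrite oppr_gt0 p0'/=; lra.
  (* N has taken the default value 0. Its [opinv] is again the default 0, unless the zero map is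
     invertible, in which case H is the zero space. *)
  rewrite /opinv; case: xgetP => [B _ iB|_]; last by [].
  have triv x : x = 0 by rewrite -(is_opinvK iB x).
  split=> [x y|x]; first by rewrite (triv x) (triv y) linear0l linear0r.
  by rewrite [X in <| _, X |>](triv x) rdotC rdot0l arithmetic_ge0.
rewrite /karcher_mean; case: xgetP => [M _ hM|_]; last by [].
split=> [|x]; last exact: is_karcher_mean_le.
by case: hM => pM _; exact: pos_op_selfadjoint.
Qed.

End PowerMean.

Lemma power_mean2_le p t X Y : pos_op dot X -> pos_op dot Y ->
  0 <= t <= 1 -> -1 <= p <= 1 ->
  selfadjoint dot (power_mean2 dot p t X Y) /\
  forall x, <| power_mean2 dot p t X Y x, x |> <= (1 - t) * <| X x, x |> + t * <| Y x, x |>.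
Proof.
move=> pX pY /andP[t0 t1] p1; rewrite /power_mean2.
have [->|tn0] := eqVneq t 0.
  split=> [|x]; first exact: pos_op_selfadjoint.
  by rewrite subr0 mul1r mul0r addr0.
have [->|tn1] := eqVneq t 1.
  split=> [|x]; first exact: pos_op_selfadjoint.
  by rewrite subrr mul0r mul1r add0r.
have two (P : 'I_2 -> Prop) : P ord0 -> P (lift ord0 ord0) -> forall i, P i.
  move=> P0 P1 i; have [->//|] := eqVneq i ord0.
  by case: (unliftP ord0 i) => [j ->|->]; rewrite ?eqxx// ord1.
have hl : prob_vector (tnth [tuple 1 - t; t]).
  split; last by rewrite !big_ord_recl big_ord0 addr0 !(tnth_nth 0)/= subrK.
  apply: two; rewrite (tnth_nth 0)/=; first by rewrite subr_gt0 lt_neqAle tn1.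
  by rewrite lt_neqAle eq_sym tn0.
have pXY i : pos_op dot (tnth [tuple X; Y] i).
  by move: i; apply: two; rewrite (tnth_nth X).
have [sM hM] := power_mean_le hl pXY p1; split=> // x.
by apply: le_trans (hM x) _; rewrite !big_ord_recl big_ord0 addr0 !(tnth_nth 0).
Qed.

(** * Monotonicity and concavity of the parameterized mean in its parameter *)

Section OrderedMean.
Variable G : forall n, ('I_n -> R) -> ('I_n -> H -> H) -> H -> H.
Hypothesis hG : ordered_mean dot G.
Variables (n : nat) (w : 'I_n -> R).
Hypothesis hw : prob_vector w.
Implicit Types As Bs : 'I_n -> H -> H.

Lemma ordered_mean_superadditive As Bs x :
  (forall i, pos_op dot (As i)) -> (forall i, pos_op dot (Bs i)) ->
  <| G w As x, x |> + <| G w Bs x, x |> <= <| G w (fun i => As i + Bs i) x, x |>.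
Proof.
(* C is the midpoint of the two tuples: concavity at s = 1/2 bounds G at C, and homogeneity with
   factor 2 turns C into the sum. *)
move=> pA pB; pose C i := (1 - 2^-1)%:C *: As i + (2^-1)%:C *: Bs i.
have h2 : 0 < 2^-1 :> R by rewrite invr_gt0.
have pC i : pos_op dot (C i).
  by apply: pos_opD; apply: pos_opZ => //; lra.
have := ordered_mean_homogeneous hG hw pC (ltr0Sn R 1).
have -> : (fun i => 2%:C *: C i) = (fun i => As i + Bs i).
  apply/funext => i; rewrite /C scalerDr !scalerA -!rmorphM.
  have -> : 2 * (1 - 2^-1) = 1 :> R by field.
  have -> : 2 * 2^-1 = 1 :> R by field.
  by rewrite !scale1r.
move=> ->; have h01 : 0 <= (2^-1 : R) <= 1 by lra.
have := loewner_rdot_le (ordered_mean_concave hG hw pA pB h01) x.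
rewrite -[(_ + _) x]/(_ *: G w As x + _ *: G w Bs x) rdotDl !rdotZl.
rewrite -/C; lra.
Qed.

Lemma ordered_mean_scalar_ge d x : 0 < d ->
  d * <| x, x |> <= <| G w (fun=> d%:C *: idfun) x, x |>.
Proof.
move=> d0; have pd : pos_op dot (d%:C *: idfun) by exact: pos_opZ pos_op_id.
have iI : is_opinv (idfun : H -> H) idfun by split=> //; exact: bounded_op_id.
have inv c : c != 0 -> opinv (c%:C *: idfun : H -> H) = (c^-1)%:C *: idfun.
  move=> c0; apply: opinvE; rewrite fmorphV.
  by apply: is_opinvZ => //; rewrite fmorph_eq0.
have [lo _] := ordered_mean_bounds hG hw (fun=> pd).
have := loewner_rdot_le lo x.
rewrite inv ?gt_eqF// -scaler_suml -rmorph_sum.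
case: (hw) => _ ->; rewrite scale1r inv ?invr_eq0 ?gt_eqF// invrK.
by rewrite -[(_ *: _) x]/(d%:C *: x) rdotZl.
Qed.

Variable As : 'I_n -> H -> H.
Hypothesis pA : forall i, pos_op dot (As i).

Lemma shift_pos_op a i : 0 < a -> pos_op dot (As i + a%:C *: idfun).
Proof. by move=> a0; apply: pos_opD => //; exact: pos_opZ pos_op_id. Qed.

Lemma rdot_param_mean a x : <| param_mean G a w As x, x |> =
  <| G w (fun i => As i + a%:C *: idfun) x, x |> - a * <| x, x |>.
Proof.
rewrite -[param_mean _ _ _ _ x]/(G w (fun i => As i + a%:C *: idfun) x - _ *: x).
by rewrite rdotBl rdotZl.
Qed.

(** By superadditivity and [ordered_mean_scalar_ge], G at the shifted tuple exceeds G at As by at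
    least a, so after subtracting a the coercivity constant of the unshifted mean survives. *)
Lemma param_mean_pos_op a : 0 < a -> pos_op dot (param_mean G a w As).
Proof.
move=> a0; have pGA := ordered_mean_pos hG hw (fun i => shift_pos_op i a0).
have [c c0 hc] := pos_op_coercive (ordered_mean_pos hG hw pA).
apply: (coercive_pos_op _ _ c0) => [||x].
- apply: bounded_opB (pos_op_bounded pGA) _; apply: bounded_opZ; exact: bounded_op_id.
- apply: selfadjointB (pos_op_selfadjoint pGA) _; apply: selfadjointZ.
  exact: selfadjoint_id.
rewrite rdot_param_mean.
have := ordered_mean_superadditive x pA (fun=> pos_opZ a0 pos_op_id).
by have := ordered_mean_scalar_ge x a0; have := hc x; lra.
Qed.

(** Adding (b - a) I to the tuple shifted by a raises G by at least b - a, which compensates the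
    larger multiple of the identity being subtracted. *)
Lemma param_mean_nondecreasing a b x : 0 < a -> a <= b ->
  <| param_mean G a w As x, x |> <= <| param_mean G b w As x, x |>.
Proof.
move=> a0; rewrite le_eqVlt => /predU1P[<-//|ab].
have ba : 0 < b - a by rewrite subr_gt0.
have := ordered_mean_superadditive x (fun i => shift_pos_op i a0) (fun=> pos_opZ ba pos_op_id).
have -> : (fun i => As i + a%:C *: idfun + (b - a)%:C *: idfun) =
    (fun i => As i + b%:C *: idfun).
  by apply/funext => i; rewrite -addrA -scalerDl -rmorphD subrKC.
by rewrite !rdot_param_mean; have := ordered_mean_scalar_ge x ba; lra.
Qed.

Lemma param_mean_concave a b t x : 0 < a -> 0 < b -> 0 <= t <= 1 ->
  (1 - t) * <| param_mean G a w As x, x |> + t * <| param_mean G b w As x, x |> <=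
  <| param_mean G ((1 - t) * a + t * b) w As x, x |>.
Proof.
move=> a0 b0 t01.
have := loewner_rdot_le (ordered_mean_concave hG hw
  (fun i => shift_pos_op i a0) (fun i => shift_pos_op i b0) t01) x.
have -> : (fun i => (1 - t)%:C *: (As i + a%:C *: idfun) + t%:C *: (As i + b%:C *: idfun)) =
    (fun i => As i + ((1 - t) * a + t * b)%:C *: idfun).
  apply/funext => i; rewrite !scalerDr !scalerA addrACA -!scalerDl -!rmorphM -!rmorphD.
  by rewrite subrK scale1r.
rewrite -[(_ + _) x]/(_ *: G w _ x + _ *: G w _ x) rdotDl !rdotZl !rdot_param_mean.
lra.
Qed.

End OrderedMean.
End OperatorMeans.
Unset Implicit Arguments.

Theorem theorem4p3 (R : realType) (H : completeNormedModType R[i])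
    (dot : {dot H for Num.conj})
    (hdot : forall x : H, `|x| ^+ 2 = dot x x)
    (G : forall n, ('I_n -> R) -> ('I_n -> H -> H) -> H -> H)
    (hG : ordered_mean dot G)
    (n : nat) (A : 'I_n -> H -> H) (hA : forall i, pos_op dot (A i))
    (w : 'I_n -> R) (hw : prob_vector w)
    (mu nu : R) (hmu : 0 < mu) (hnu : 0 < nu)
    (t : R) (ht : 0 <= t <= 1) (p : R) (hp : -1 <= p < 1) :
  let K := (mu + nu) ^+ 2 / (4 * mu * nu) in
  loewner dot
    (power_mean2 dot p t (param_mean G (mu / K) w A) (param_mean G (nu / K) w A))
    (param_mean G
       (scalar_power_mean p (tnth [tuple 1 - t; t]) (tnth [tuple mu; nu])) w A).
Proof.
move=> K; have p1 : -1 <= p <= 1 by case/andP: hp => -> /ltW ->.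
have K0 : 0 < K by rewrite divr_gt0 ?exprn_gt0 ?addr_gt0 ?mulr_gt0.
have muK : 0 < mu / K by exact: divr_gt0.
have nuK : 0 < nu / K by exact: divr_gt0.
have pmu := param_mean_pos_op hdot hG hw hA muK.
have pnu := param_mean_pos_op hdot hG hw hA nuK.
have [sP hP] := power_mean2_le hdot pmu pnu ht p1.
(* Monotonicity in the parameter starts from a positive one; this also makes the larger parameter,
   the scalar power mean, positive. *)
have s0 : 0 < (1 - t) * (mu / K) + t * (nu / K).
  case/andP: ht; rewrite le_eqVlt => /predU1P[<-|t0] t1.
    by rewrite subr0 mul0r addr0 mul1r.
  by apply: ltr_wpDl; [apply: mulr_ge0; rewrite ?subr_ge0// ltW|exact: mulr_gt0].
have sPp := arithmetic_le_power_mean hmu hnu ht p1.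
apply/loewnerP => [|x].
  apply: selfadjointB sP; apply: pos_op_selfadjoint.
  exact: (param_mean_pos_op hdot hG hw hA (lt_le_trans s0 sPp)).
apply: le_trans (hP x) _.
apply: le_trans (param_mean_concave hdot hG hw hA x muK nuK ht) _.
exact: param_mean_nondecreasing.
Qed.
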